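(* Let $f(r)=r$ and let $q_0=(x_0,y_0,z_0)\in\mathbb R^3\setminus\Sigma$, with $r_0=\sqrt{x_0^2+y_0^2}$. For every unit-speed geodesic $\gamma$ from $q_0$ with initial covector $\lambda_0=(u_0,v_0,w_0)\in E_1$, $$t_{\mathrm{cut}}(\gamma)=\frac{\pi}{|w_0|}\qquad(\text{equal to }+\infty\text{ if }w_0=0).$$ Moreover, $$\mathrm{Cut}(q_0)=\Big\{(-x_0,-y_0,z):\ |z-z_0|\ge\frac{\pi r_0^2}{2}\Big\}.$$
   Context: Consider $\mathbb R^3$ with points $q=(x,y,z)$, $r=\sqrt{x^2+y^2}$, $\Sigma=\{r=0\}$, and the vector fields $X=\partial_x$, $Y=\partial_y$, $Z=r\,\partial_z$ (the case $f(r)=r$). Admissible curves, length and $d_{CC}$: - An absolutely continuous curve is admissible if its derivative is a.e. an $L^2$ combination of $X,Y,Z$. - Its length is $\ell(\gamma)=\int\sqrt{\dot x^2+\dot y^2+\dot z^2/r^2}\,dt$. - $d_{CC}$ is the induced infimum-of-length distance. - A length minimizer is an admissible curve not longer than any admissible curve with the same endpoints. Normal trajectories (geodesics) are projections of solutions of $$\dot x=u,\quad \dot y=v,\quad \dot z=r^2w,\quad \dot u=-w^2x,\quad \dot v=-w^2y,\quad \dot w=0,$$ with initial covector $\lambda_0=(u_0,v_0,w_0)$. The unit energy shell is $E_1=\{\lambda_0:u_0^2+v_0^2+r_0^2w_0^2=1\}$. Cut time and cut locus: - $t_{\mathrm{cut}}(\gamma)=\sup\{t>0:\gamma|_{[0,t]}\text{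 is a length minimizer}\}$. - $\mathrm{Cut}(q_0)$ is the set of points $\gamma(t_{\mathrm{cut}}(\gamma))$ over all unit-speed geodesics from $q_0$ with finite cut time. *)

(* Defs.v *)
From HB Require Import structures.
From mathcomp Require Import all_boot all_order all_algebra.
From mathcomp Require Import all_classical all_reals all_analysis.
Set Implicit Arguments. Unset Strict Implicit. Unset Printing Implicit Defensive.
Import Order.TTheory GRing.Theory Num.Theory.
Import numFieldNormedType.Exports.
Local Open Scope classical_set_scope.
Local Open Scope ring_scope.

Section Grushin.
Variable R : realType.

Definition pt := (R * R * R)%type.
Definition px (q : pt) : R := q.1.1.
Definition py (q : pt) : R := q.1.2.
Definition pz (q : pt) : R := q.2.

Definition rcyl (q : pt) : R := Num.sqrt (px q ^+ 2 + py q ^+ 2).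

Definition mu := @lebesgue_measure R.

Definition L2 (D : set R) (f : R -> R) : Prop :=
  measurable_fun D f /\ (\int[mu]_(t in D) ((f t) ^+ 2)%:E < +oo)%E.

(* c restricted to [a,b] is admissible with controls (u, v, w) in L^2:
   c is absolutely continuous with c' = u X + v Y + w Z a.e., i.e.
   c(s) = c(a) + \int_a^s (u, v, r(c) w) for s in [a,b]. *)
Definition adm_rep (a b : R) (c : R -> pt) (u v w : R -> R) : Prop :=
  a <= b /\
  L2 `[a, b] u /\ L2 `[a, b] v /\ L2 `[a, b] w /\
  mu.-integrable `[a, b] (fun t => (u t)%:E) /\
  mu.-integrable `[a, b] (fun t => (v t)%:E) /\
  mu.-integrable `[a, b] (fun t => (rcyl (c t) * w t)%:E) /\
  forall s, a <= s <= b ->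
    px (c s) = px (c a) + Rintegral mu `[a, s] u /\
    py (c s) = py (c a) + Rintegral mu `[a, s] v /\
    pz (c s) = pz (c a) + Rintegral mu `[a, s] (fun t => rcyl (c t) * w t).

Definition admissible (a b : R) (c : R -> pt) : Prop :=
  exists u v w, adm_rep a b c u v w.

(* length  int sqrt(xdot^2 + ydot^2 + zdot^2 / r^2)  with xdot = u, ydot = v,
   zdot = r w a.e.  (with the MathComp convention 0/0 = 0 on Sigma) *)
Definition clength (a b : R) (c : R -> pt) (u v w : R -> R) : \bar R :=
  (\int[mu]_(t in `[a, b])
     (Num.sqrt (u t ^+ 2 + v t ^+ 2 + (rcyl (c t) * w t) ^+ 2 / rcyl (c t) ^+ 2))%:E)%E.

Definition minimizer (a b : R) (c : R -> pt) : Prop :=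
  exists u v w, adm_rep a b c u v w /\
  forall a' b' (c' : R -> pt) u' v' w', adm_rep a' b' c' u' v' w' ->
    c' a' = c a -> c' b' = c b ->
    (clength a b c u v w <= clength a' b' c' u' v' w')%E.

Definition E1 (q0 : pt) (u0 v0 w0 : R) : Prop :=
  u0 ^+ 2 + v0 ^+ 2 + rcyl q0 ^+ 2 * w0 ^+ 2 = 1.

(* gam is the normal trajectory from q0 with initial covector (u0, v0, w0):
   projection of the solution of
   x' = u, y' = v, z' = r^2 w, u' = -w^2 x, v' = -w^2 y, w' = 0. *)
Definition geodesic (q0 : pt) (u0 v0 w0 : R) (gam : R -> pt) : Prop :=
  exists x y z u v : R -> R,
    (forall t, gam t = (x t, y t, z t)) /\
    x 0 = px q0 /\ y 0 = py q0 /\ z 0 = pz q0 /\ u 0 = u0 /\ v 0 = v0 /\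
    forall t : R,
      is_derive t 1 x (u t) /\ is_derive t 1 y (v t) /\
      is_derive t 1 z ((x t ^+ 2 + y t ^+ 2) * w0) /\
      is_derive t 1 u (- (w0 ^+ 2 * x t)) /\ is_derive t 1 v (- (w0 ^+ 2 * y t)).

Definition tcut (gam : R -> pt) : \bar R :=
  ereal_sup [set (t%:E)%E | t in [set t : R | 0 < t /\ minimizer 0 t gam]].

Definition Cut (q0 : pt) : set pt :=
  [set p | exists u0 v0 w0 (gam : R -> pt) (T : R),
     E1 q0 u0 v0 w0 /\ geodesic q0 u0 v0 w0 gam /\ tcut gam = (T%:E)%E /\ p = gam T].

End Grushin.

(* Main.v *)
Require Import Defs.
From HB Require Import structures.
From mathcomp Require Import all_boot all_order all_algebra.
From mathcomp Require Import all_classical all_reals all_analysis.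
From mathcomp Require Import measurable_realfun ring lra.
Import Order.TTheory GRing.Theory Num.Theory.
Import numFieldNormedType.Exports.
Local Open Scope classical_set_scope.
Local Open Scope ring_scope.

(** Lower bound: let om = |w0|, T = pi / om, and let a competitor with speed s
join q0 to the antipodal end of the geodesic. If its length were L < T, let the
clock tau run from - L / 2 to L / 2 at rate s along it; with q = (x, y), the
function
  Phi = 2 w0 z - om tan (om tau) (|q|^2 + |q0|^2) - 2 om (q . q0) / cos (om tau)
grows at rate at most s, because the excess is a sum of squares (Phi solves the
Hamilton-Jacobi inequality of the harmonic oscillator into which the multiplier
w0 turns the problem), and its total increase is at least
2 w0 (z(T) - z(0)) = T; hence L >= T. The rate of s is perturbed by a constant
so that the clock never stops.

After T: (x, y) is perturbed along a fixed direction of the plane by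
sin (pi s / t). As the plane has dimension 2, the direction can be chosen so
that the first variation of int r^2 vanishes; for t > T the second variation of
the energy at fixed height is then negative. *)

Set Implicit Arguments.
Unset Strict Implicit.

(** * Calculus of absolutely continuous functions *)

Section Primitive.
Variable R : realType.
Implicit Types (a b s t : R) (F G f g k m : R -> R).
Notation mu := (@lebesgue_measure R).

(* [F] is absolutely continuous on [a, b], with derivative [f] a.e. *)
Definition primitive a b F f :=
  mu.-integrable `[a, b] (EFin \o f) /\
  forall s, a <= s <= b -> F s = F a + \int[mu]_(x in `[a, s]) f x.

Lemma integrable_subitv a b s t f : a <= s -> t <= b ->
  mu.-integrable `[a, b] (EFin \o f) -> mu.-integrable `[s, t] (EFin \o f).
Proof.
move=> as_ tb; apply: integrableS => //.
by apply: subset_itv; rewrite bnd_simp.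
Qed.

Lemma integrable_itvZ s t (c : R) f : mu.-integrable `[s, t] (EFin \o f) ->
  mu.-integrable `[s, t] (EFin \o (fun x => c * f x)).
Proof. by move=> fi; apply: (integrableZl _ c fi). Qed.

Lemma integrable_itvD s t f g : mu.-integrable `[s, t] (EFin \o f) ->
  mu.-integrable `[s, t] (EFin \o g) ->
  mu.-integrable `[s, t] (EFin \o (fun x => f x + g x)).
Proof. by move=> fi gi; apply: (integrableD _ fi gi). Qed.

Lemma Rintegral_itv_split a b s t f : a <= s -> s <= t -> t <= b ->
  mu.-integrable `[a, b] (EFin \o f) ->
  \int[mu]_(x in `[a, t]) f x =
  \int[mu]_(x in `[a, s]) f x + \int[mu]_(x in `[s, t]) f x.
Proof.
move=> as_ st tb fi.
have fi' := integrable_subitv (lexx a) tb fi.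
rewrite -[X in _ + X]Rintegral_itv_obnd_cbnd; last first.
  apply: integrableS fi' => //.
  by apply: subset_itv; rewrite bnd_simp.
by rewrite -(Rintegral_itvB fi') ?bnd_simp // addrC subrK.
Qed.

Lemma primitiveB a b s t F f : primitive a b F f -> a <= s -> s <= t -> t <= b ->
  F t - F s = \int[mu]_(x in `[s, t]) f x.
Proof.
move=> [fi Ff] as_ st tb.
rewrite (Ff t) ?(Ff s) ?as_ ?(le_trans as_ st) ?(le_trans st tb) ?tb //.
rewrite (Rintegral_itv_split as_ st tb fi); ring.
Qed.

Lemma within_continuous_dominated a b m k (K : R) : {within `[a, b], continuous m} ->
  (forall s t, s \in `[a, b] -> t \in `[a, b] -> `|k s - k t| <= K * `|m s - m t|) ->
  {within `[a, b], continuous k}.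
Proof.
move=> /subspace_continuousP mc km; apply/subspace_continuousP => x xab.
apply/cvgrPdist_lt => e e0.
have K0 : 0 < `|K| + 1 by rewrite ltr_wpDl.
have /cvgrPdist_lt/(_ (e / (`|K| + 1))) := mc x xab.
rewrite divr_gt0// => /(_ isT); rewrite !near_withinE; apply: filterS => t H tab.
apply: le_lt_trans (km x t _ _) _ => //.
apply: (@le_lt_trans _ _ ((`|K| + 1) * `|m x - m t|)).
  by rewrite ler_wpM2r// (le_trans (ler_norm _))// lerDl.
by rewrite mulrC -ltr_pdivlMr// H.
Qed.

Lemma primitive_dist a b s t F f : primitive a b F f ->
  a <= s -> s <= t -> t <= b ->
  `|F t - F s| <= \int[mu]_(x in `[s, t]) `|f x|.
Proof.
move=> Ff as_ st tb; rewrite (primitiveB Ff as_ st tb).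
by apply: le_normr_Rintegral => //; apply: integrable_subitv Ff.1.
Qed.

Lemma primitive_norm a b f : mu.-integrable `[a, b] (EFin \o f) ->
  primitive a b (fun s => \int[mu]_(x in `[a, s]) `|f x|) (fun x => `|f x|).
Proof.
move=> fi; split; first exact: integrable_norm.
by move=> s _; rewrite set_itv1 Rintegral_set1 add0r.
Qed.

Lemma primitive_continuous a b F f : a <= b -> primitive a b F f ->
  {within `[a, b], continuous F}.
Proof.
move=> ab Ff; have [fi FE] := Ff.
apply: (within_continuous_dominated (K := 1)
  (parameterized_integral_continuous ab fi)) => s t.
rewrite !in_itv/= => sab tab.
by rewrite mul1r FE// [F t]FE// /parameterized_integral opprD addrACA subrr add0r.
Qed.

(* [m] serves as a clock: cutting [a, b] into n pieces on which [m] grows by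
   the same amount bounds [F b - F a] by n * C * ((m b - m a) / n) ^ 2. *)
Lemma quadratic_increments_cst a b F m (C : R) : a <= b ->
  {within `[a, b], continuous m} ->
  (forall s t, a <= s -> s <= t -> t <= b -> m s <= m t) ->
  (forall s t, a <= s -> s <= t -> t <= b ->
     `|F t - F s| <= C * (m t - m s) ^+ 2) ->
  F b = F a.
Proof.
move=> ab mc mm FC.
(* Induction on the number of clock steps of size [d]. The point [p] is any point where [m] has
   reached its i-th level, since [m] may be constant on intervals; the intermediate value theorem
   supplies a point of the previous level. *)
have step n (d : R) : 0 <= d -> forall i p, (i <= n)%N -> a <= p -> p <= b ->
    m p = m a + i%:R * d -> `|F p - F a| <= i%:R * (C * d ^+ 2).
  move=> d0; elim=> [|i IH] p ip ap pb mp.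
    by rewrite (le_trans (FC _ _ (lexx a) ap pb))// mp !mul0r addr0 subrr expr0n mulr0.
  have mcp : {within `[a, p], continuous m}.
    by apply: continuous_subspaceW mc; apply: subset_itv; rewrite bnd_simp.
  have [|q] := IVT ap mcp (v := m a + i%:R * d).
    rewrite ge_min le_max lerDl mulr_ge0//= mp lerD2l ler_wpM2r ?orbT//.
    by rewrite ler_nat.
  rewrite in_itv/= => /andP[aq qp] mq.
  have qb := le_trans qp pb.
  rewrite -(subrK (F q) (F p)) -addrA (le_trans (ler_normD _ _))//.
  rewrite [i.+1%:R]mulrS mulrDl mul1r lerD ?IH ?(ltnW ip)//.
  rewrite (le_trans (FC _ _ aq qp pb))// mp mq.
  by rewrite (_ : _ - _ = d)// [i.+1%:R]mulrS; ring.
set M := m b - m a.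
have M0 : 0 <= M by rewrite subr_ge0 mm.
apply/eqP; rewrite -subr_eq0 -normr_eq0; apply/negPn/negP => N0.
have Npos : 0 < `|F b - F a| by rewrite lt_neqAle eq_sym N0 /=.
have bnd n : `|F b - F a| * n.+1%:R <= C * M ^+ 2.
  have n0 : 0 < n.+1%:R :> R by [].
  have n0' : n.+1%:R != 0 :> R by [].
  have := step n.+1 (M / n.+1%:R) _ n.+1 b (leqnn _) ab (lexx b).
  rewrite divr_ge0// => /(_ isT); rewrite mulrCA divff// mulr1 /M [m a + _]addrC subrK.
  move=> /(_ erefl); rewrite -/M -ler_pdivlMr// => H.
  by rewrite (le_trans H)// le_eqVlt; apply/orP; left; apply/eqP; field.
(* The bound holds for every n, and fails once n + 1 exceeds C M ^ 2 / |F b - F a|. *)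
have := bnd (Num.truncn (C * M ^+ 2 / `|F b - F a|)).
by rewrite mulrC -ler_pdivlMr// leNgt truncnS_gt.
Qed.

(** Subtracting the integral of [f] reduces this to [quadratic_increments_cst]. The product and
    chain rules below rest on it: their linearization errors are quadratic in the variations of the
    functions involved. *)
Lemma primitive_quadratic a b F f m (C : R) : a <= b ->
  mu.-integrable `[a, b] (EFin \o f) ->
  {within `[a, b], continuous m} ->
  (forall s t, a <= s -> s <= t -> t <= b -> m s <= m t) ->
  (forall s t, a <= s -> s <= t -> t <= b ->
     `|F t - F s - \int[mu]_(x in `[s, t]) f x| <= C * (m t - m s) ^+ 2) ->
  primitive a b F f.
Proof.
move=> ab fi mc mm FC; split => // s /andP[as_ sb].
pose H t := F t - \int[mu]_(x in `[a, t]) f x.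
suff : H s = H a.
  rewrite /H set_itv1 Rintegral_set1 subr0 => <-; by rewrite subrK.
apply: (quadratic_increments_cst (m := m) (C := C)) => //.
- by apply: continuous_subspaceW mc; apply: subset_itv; rewrite bnd_simp.
- by move=> p q ap pq qs; apply: mm => //; exact: le_trans sb.
- move=> p q ap pq qs; have qb := le_trans qs sb.
  have := FC p q ap pq qb; congr (_ <= _); congr (`|_|).
  rewrite /H (@Rintegral_itv_split a b p q)//; ring.
Qed.

Lemma Rintegral_norm_le_mul s t f k (D : R) :
  mu.-integrable `[s, t] (EFin \o f) ->
  mu.-integrable `[s, t] (EFin \o (f \* k)) ->
  (forall x, s <= x <= t -> `|k x| <= D) ->
  `|\int[mu]_(x in `[s, t]) (f x * k x)| <= D * \int[mu]_(x in `[s, t]) `|f x|.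
Proof.
move=> fi fki kD.
have nfi := integrable_norm fi.
apply: le_trans (le_normr_Rintegral _ fki) _ => //.
rewrite -RintegralZl//; apply: le_Rintegral => //.
- exact: integrable_norm fki.
- exact: integrable_itvZ nfi.
- move=> x; rewrite /= in_itv/= => /kD kx.
  by rewrite normrM mulrC ler_wpM2r.
Qed.

Lemma integrable_mul_continuous a b f k :
  mu.-integrable `[a, b] (EFin \o f) -> {within `[a, b], continuous k} ->
  mu.-integrable `[a, b] (EFin \o (f \* k)).
Proof.
move=> fi kc.
have mk : measurable_fun `[a, b] k.
  by apply: subspace_continuous_measurable_fun.
have bk : [bounded k x | x in `[a, b]].
  have /compact_bounded[M [_ Mk]] := continuous_compact kc (@segment_compact _ a b).
  by exists M; split; rewrite ?num_real // => ? ? ? ?; exact: Mk.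
exact: (integrableMl _ fi mk bk).
Qed.

Lemma Rintegral_norm_ge0 s t f : 0 <= \int[mu]_(x in `[s, t]) `|f x|.
Proof. by apply: Rintegral_ge0. Qed.

Lemma primitive_cst a b (c : R) : primitive a b (cst c) (cst 0).
Proof.
split; first exact: integrable0.
by move=> s _; rewrite Rintegral_cst// mul0r addr0.
Qed.

Lemma primitiveD a b F f G g : primitive a b F f -> primitive a b G g ->
  primitive a b (F \+ G) (f \+ g).
Proof.
move=> [fi Ff] [gi Gg]; split; first exact: integrable_itvD.
move=> s sab /=; have /andP[_ sb] := sab.
rewrite RintegralD//; [|exact: integrable_subitv fi|exact: integrable_subitv gi].
by rewrite Ff// Gg//; ring.
Qed.

(** The clock is the sum of the variations of [F] and [G]. On [s, t] the error of the product rule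
    is a sum of two integrals, each at most the product of the two variations. *)
Lemma primitiveM a b F f G g : a <= b -> primitive a b F f -> primitive a b G g ->
  primitive a b (F \* G) (fun x => f x * G x + g x * F x).
Proof.
move=> ab Ff Gg.
have fi := Ff.1; have gi := Gg.1.
have Fc := primitive_continuous ab Ff.
have Gc := primitive_continuous ab Gg.
have fGi := integrable_mul_continuous fi Gc.
have gFi := integrable_mul_continuous gi Fc.
have mp := primitiveD (primitive_norm fi) (primitive_norm gi).
set m := _ \+ _ in mp.
have mE s t : a <= s -> s <= t -> t <= b -> m t - m s =
    \int[mu]_(x in `[s, t]) `|f x| + \int[mu]_(x in `[s, t]) `|g x|.
  move=> as_ st tb; rewrite (primitiveB mp as_ st tb) RintegralD//;
    exact/integrable_norm/(integrable_subitv (a := a) (b := b)).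
apply: (primitive_quadratic (m := m) (C := 1)) => //.
- exact: integrable_itvD fGi gFi.
- exact: primitive_continuous mp.
- by move=> s t as_ st tb; rewrite -subr_ge0 mE// addr_ge0// Rintegral_norm_ge0.
move=> s t as_ st tb.
have sub (h : R -> R) : mu.-integrable `[a, b] (EFin \o h) -> mu.-integrable `[s, t] (EFin \o h).
  exact: integrable_subitv.
have csub (h : R -> R) : {within `[a, b], continuous h} -> {within `[s, t], continuous h}.
  by move=> hc; apply: continuous_subspaceW hc; apply: subset_itv; rewrite bnd_simp.
have fGti : mu.-integrable `[s, t] (EFin \o (f \* (fun x => G t - G x))).
  apply: integrable_mul_continuous; first exact: sub.
  apply: (within_continuous_dominated (m := G) (K := 1)); first exact: csub.
  by move=> x y _ _; rewrite mul1r opprB addrC addrA subrK distrC.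
have gFti : mu.-integrable `[s, t] (EFin \o (g \* (fun x => F s - F x))).
  apply: integrable_mul_continuous; first exact: sub.
  apply: (within_continuous_dominated (m := F) (K := 1)); first exact: csub.
  by move=> x y _ _; rewrite mul1r opprB addrC addrA subrK distrC.
have -> : (F \* G) t - (F \* G) s - \int[mu]_(x in `[s, t]) (f x * G x + g x * F x) =
   \int[mu]_(x in `[s, t]) (f x * (G t - G x)) +
   \int[mu]_(x in `[s, t]) (g x * (F s - F x)).
  (* Freezing [G] at [t] in one term and [F] at [s] in the other splits the increment of the product
     without remainder. *)
  have -> : (F \* G) t - (F \* G) s = (F t - F s) * G t + (G t - G s) * F s.
    by rewrite /=; ring.
  rewrite (primitiveB Ff as_ st tb) (primitiveB Gg as_ st tb).
  rewrite -!RintegralZr ?sub//.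
  have Ri h c : mu.-integrable `[a, b] (EFin \o h) ->
      mu.-integrable `[s, t] (EFin \o (fun x => h x * c)).
    move=> /sub /(integrable_itvZ c).
    by rewrite (_ : (fun x => h x * c) = fun x => c * h x)//; apply/funext => x; rewrite mulrC.
  rewrite [in X in _ - X]RintegralD ?sub// opprD addrACA -!RintegralB ?Ri ?sub//.
  by congr (_ + _); apply: eq_Rintegral => x _; rewrite mulrBr.
have If := Rintegral_norm_ge0 s t f; have Ig := Rintegral_norm_ge0 s t g.
have sI h x : mu.-integrable `[a, b] (EFin \o h) -> s <= x <= t ->
    \int[mu]_(y in `[s, x]) `|h y| <= \int[mu]_(y in `[s, t]) `|h y| /\
    \int[mu]_(y in `[x, t]) `|h y| <= \int[mu]_(y in `[s, t]) `|h y|.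
  move=> /sub hi /andP[sx xt].
  rewrite (@Rintegral_itv_split s t x t)//; last exact: integrable_norm hi.
  by rewrite lerDl lerDr !Rintegral_norm_ge0.
apply: le_trans (ler_normD _ _) _; rewrite mul1r mE//.
apply: (@le_trans _ _ ((\int[mu]_(x in `[s, t]) `|g x|) * (\int[mu]_(x in `[s, t]) `|f x|)
   + (\int[mu]_(x in `[s, t]) `|f x|) * (\int[mu]_(x in `[s, t]) `|g x|))); last by nra.
apply: lerD; [apply: (Rintegral_norm_le_mul (sub _ fi) fGti)
  |apply: (Rintegral_norm_le_mul (sub _ gi) gFti)] => x sxt;
  have /andP[sx xt] := sxt.
- apply: le_trans (primitive_dist Gg (le_trans as_ sx) xt tb) _.
  exact: (sI g x gi sxt).2.
- rewrite distrC; apply: le_trans (primitive_dist Ff as_ sx (le_trans xt tb)) _.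
  exact: (sI f x fi sxt).1.
Qed.

(** The clock is the variation of [F]. One [K] pays for the Taylor remainder of [phi], a second one
    for the change of [phi'] along [F]. The domain [D] admits functions such as the inverse, regular
    only away from a singularity. *)
Lemma primitive_comp a b F f (D : R -> Prop) (phi phi' : R -> R) (K : R) :
  a <= b -> 0 <= K -> primitive a b F f ->
  (forall s, a <= s <= b -> D (F s)) ->
  (forall x y, D x -> D y -> `|phi' y - phi' x| <= K * `|y - x|) ->
  (forall x y, D x -> D y ->
    `|phi y - phi x - phi' x * (y - x)| <= K * `|y - x| ^+ 2) ->
  primitive a b (phi \o F) (fun x => f x * phi' (F x)).
Proof.
move=> ab K0 Ff FD lip tay; have fi := Ff.1.
have Fc := primitive_continuous ab Ff.
have phic : {within `[a, b], continuous (phi' \o F)}.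
  apply: (within_continuous_dominated (K := K) Fc) => s t.
  by rewrite !in_itv/= => /FD Ds /FD Dt; apply: lip.
have mp := primitive_norm fi.
set m := (fun _ => _) in mp.
apply: (primitive_quadratic (m := m) (C := K + K)) => //.
- exact: integrable_mul_continuous.
- exact: primitive_continuous mp.
- move=> s t as_ st tb.
  by rewrite -subr_ge0 (primitiveB mp)// Rintegral_norm_ge0.
move=> s t as_ st tb.
have sub (h : R -> R) : mu.-integrable `[a, b] (EFin \o h) -> mu.-integrable `[s, t] (EFin \o h).
  exact: integrable_subitv.
have Ds : D (F s) by apply: FD; rewrite as_ (le_trans st).
have Dt : D (F t) by apply: FD; rewrite tb (le_trans as_).
have fpi : mu.-integrable `[s, t] (EFin \o (f \* (fun x => phi' (F s) - phi' (F x)))).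
  apply: integrable_mul_continuous; first exact: sub.
  apply: (within_continuous_dominated (m := phi' \o F) (K := 1)).
    by apply: continuous_subspaceW phic; apply: subset_itv; rewrite bnd_simp.
  by move=> x y _ _; rewrite mul1r opprB addrC addrA subrK distrC.
have fi2 := integrable_mul_continuous fi phic.
have -> : (phi \o F) t - (phi \o F) s - \int[mu]_(x in `[s, t]) (f x * phi' (F x)) =
   phi (F t) - phi (F s) - phi' (F s) * (F t - F s) +
   \int[mu]_(x in `[s, t]) (f x * (phi' (F s) - phi' (F x))).
  have -> : \int[mu]_(x in `[s, t]) (f x * (phi' (F s) - phi' (F x))) =
      \int[mu]_(x in `[s, t]) (phi' (F s) * f x - f x * phi' (F x)).
    by apply: eq_Rintegral => x _; ring.
  rewrite RintegralB//; [|exact/integrable_itvZ/sub|exact: (sub _ fi2)].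
  rewrite RintegralZl ?sub// -(primitiveB Ff as_ st tb)/=; ring.
rewrite mulrDl; apply: le_trans (ler_normD _ _) _.
have mE : m t - m s = \int[mu]_(x in `[s, t]) `|f x|.
  exact: primitiveB mp as_ st tb.
apply: lerD.
  apply: le_trans (tay _ _ Ds Dt) _; rewrite ler_wpM2l// lerXn2r ?nnegrE//.
    by rewrite mE Rintegral_norm_ge0.
  by rewrite mE; exact: primitive_dist Ff as_ st tb.
rewrite expr2 mulrA {2}mE.
apply: (Rintegral_norm_le_mul (sub _ fi) fpi) => x /andP[sx xt].
have xb := le_trans xt tb.
have Dx : D (F x) by apply: FD; rewrite xb (le_trans as_).
apply: le_trans (lip _ _ Dx Ds) _; rewrite ler_wpM2l// distrC.
apply: le_trans (primitive_dist Ff as_ sx xb) _.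
rewrite mE (@Rintegral_itv_split s t x t)// ?lerDl ?Rintegral_norm_ge0//.
exact/integrable_norm/sub.
Qed.

Lemma primitiveV a b F f (c : R) : a <= b -> 0 < c -> primitive a b F f ->
  (forall s, a <= s <= b -> c <= F s) ->
  primitive a b (fun s => (F s)^-1) (fun x => f x * (- (F x) ^- 2)).
Proof.
move=> ab c0 Ff Fc.
have ci : 0 < c^-1 by rewrite invr_gt0.
have inv_le x : c <= x -> 0 < x^-1 <= c^-1.
  move=> cx; have x0 := lt_le_trans c0 cx.
  by rewrite invr_gt0 x0 lef_pV2// posrE.
(* [K] bounds the second derivative 2 / x ^ 3 of the inverse on x >= c. *)
apply: (primitive_comp (D := fun x => c <= x) (phi := fun x => x^-1)
  (phi' := fun x => - x ^- 2) (K := 2 * c^-1 ^+ 3)) => //.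
- by rewrite mulr_ge0// exprn_ge0// ltW.
- move=> x y cx cy.
  have /andP[x0 xc] := inv_le _ cx; have /andP[y0 yc] := inv_le _ cy.
  have xn : x != 0 by rewrite gt_eqF// (lt_le_trans c0).
  have yn : y != 0 by rewrite gt_eqF// (lt_le_trans c0).
  have -> : - y ^- 2 - - x ^- 2 = (x^-1 * x^-1 * y^-1 + x^-1 * y^-1 * y^-1) * (y - x).
    by field; rewrite xn yn.
  rewrite normrM ler_wpM2r// ger0_norm; last by nra.
  have P1 : x^-1 * x^-1 <= c^-1 * c^-1 by nra.
  have P2 : y^-1 * y^-1 <= c^-1 * c^-1 by nra.
  have P3 : x^-1 * x^-1 * y^-1 <= c^-1 * c^-1 * c^-1 by nra.
  have P4 : y^-1 * y^-1 * x^-1 <= c^-1 * c^-1 * c^-1 by nra.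
  rewrite !exprS expr0; nra.
- move=> x y cx cy.
  have /andP[x0 xc] := inv_le _ cx; have /andP[y0 yc] := inv_le _ cy.
  have xn : x != 0 by rewrite gt_eqF// (lt_le_trans c0).
  have yn : y != 0 by rewrite gt_eqF// (lt_le_trans c0).
  have -> : y^-1 - x^-1 - - x ^- 2 * (y - x) = (x^-1 * x^-1 * y^-1) * (y - x) ^+ 2.
    by field; rewrite xn yn.
  rewrite normrM normrX ler_wpM2r// ?exprn_ge0// ger0_norm; last by nra.
  have P1 : x^-1 * x^-1 <= c^-1 * c^-1 by nra.
  have P3 : x^-1 * x^-1 * y^-1 <= c^-1 * c^-1 * c^-1 by nra.
  rewrite !exprS expr0; nra.
Qed.

Lemma lipschitz_of_derive (phi phi' : R -> R) (K x y : R) :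
  (forall z : R, is_derive z 1 phi (phi' z)) -> (forall z, `|phi' z| <= K) ->
  `|phi y - phi x| <= K * `|y - x|.
Proof.
move=> dphi bphi.
wlog xy : x y / x <= y.
  by move=> H; case: (leP x y) => [/H //|/ltW /H]; rewrite distrC [`|x - y|]distrC.
have [] := MVT_segment xy (fun z _ => dphi z).
  by apply: derivable_within_continuous => z _; have [] := dphi z.
by move=> z _ ->; rewrite normrM ler_wpM2r.
Qed.

(** By the mean value theorem a bounded second derivative gives both estimates required by
    [primitive_comp], on the whole line. *)
Lemma primitive_comp_derive2 a b F f (phi phi' phi'' : R -> R) (K : R) : a <= b ->
  primitive a b F f ->
  (forall z : R, is_derive z 1 phi (phi' z)) ->
  (forall z : R, is_derive z 1 phi' (phi'' z)) ->
  (forall z, `|phi'' z| <= K) ->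
  primitive a b (phi \o F) (fun x => f x * phi' (F x)).
Proof.
move=> ab Ff d1 d2 bK.
have K0 : 0 <= K := le_trans (normr_ge0 _) (bK 0).
apply: (primitive_comp (D := fun=> True) (K := K)) => //.
  by move=> x y _ _; exact: lipschitz_of_derive d2 bK.
move=> x y _ _.
(* The mean value point is within |v - u| of both ends, which serves both orders of [x] and [y]. *)
have tay u v : u <= v -> exists2 c, `|c - u| <= `|v - u| /\ `|c - v| <= `|v - u| &
    phi v - phi u = phi' c * (v - u).
  move=> uv; have [] := MVT_segment uv (fun z _ => d1 z).
    by apply: derivable_within_continuous => z _; have [] := d1 z.
  move=> c; rewrite in_itv/= => /andP[uc cv] E; exists c => //.
  rewrite [`|c - v|]distrC !ger0_norm ?subr_ge0//; split; lra.
suff [c cx ->] : exists2 c, `|c - x| <= `|y - x| & phi y - phi x = phi' c * (y - x).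
  rewrite -mulrBl normrM expr2 mulrA ler_wpM2r//.
  by apply: le_trans (lipschitz_of_derive x c d2 bK) _; rewrite ler_wpM2l.
have [/tay[c [cu _] E]|/ltW/tay[c [_ cv] E]] := leP x y; first by exists c.
by exists c; [rewrite [`|y - x|]distrC | rewrite -opprB E -mulrN opprB].
Qed.

(** The fundamental theorem of calculus; [f'] supplies the continuity of [f]. *)
Lemma primitive_derive a b (F f f' : R -> R) :
  (forall z : R, is_derive z 1 F (f z)) -> (forall z : R, is_derive z 1 f (f' z)) ->
  primitive a b F f.
Proof.
move=> dF df.
have fc : continuous f.
  by move=> x; apply/differentiable_continuous/derivable1_diffP; have [] := df x.
have Fc : continuous F.
  by move=> x; apply/differentiable_continuous/derivable1_diffP; have [] := dF x.
split.
  apply: continuous_compact_integrable; first exact: segment_compact.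
  exact: continuous_subspaceT.
move=> s /andP[]; rewrite le_eqVlt => /predU1P[<- _|as_ _].
  by rewrite set_itv1 Rintegral_set1 addr0.
rewrite /Rintegral (continuous_FTC2 as_ (F := F)) //.
- by rewrite -EFinB/= [RHS]addrC subrK.
- exact: continuous_subspaceT.
- split.
  + by move=> x _; have [] := dF x.
  + exact/cvg_at_right_filter/Fc.
  + exact/cvg_at_left_filter/Fc.
- by move=> x _; rewrite derive1E; have [] := dF x.
Qed.

Lemma primitive_eq a b F f G g : primitive a b F f ->
  (forall s, a <= s <= b -> F s = G s) -> (forall s, a <= s <= b -> f s = g s) ->
  primitive a b G g.
Proof.
move=> [fi Ff] FG fg; split.
  by apply: eq_integrable fi => // x; rewrite inE/= in_itv/= => /fg ->.
move=> s sab; have /andP[as_ sb] := sab.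
rewrite -!FG ?lexx ?(le_trans as_)// Ff//; congr (_ + _).
apply: eq_Rintegral => x; rewrite inE/= in_itv/= => /andP[ax xs].
by rewrite fg// ax (le_trans xs).
Qed.

Lemma primitiveZ a b F f (c : R) : primitive a b F f ->
  primitive a b (fun s => c * F s) (fun s => c * f s).
Proof.
move=> [fi Ff]; split; first exact: integrable_itvZ.
move=> s sab; have /andP[_ sb] := sab.
rewrite Ff// RintegralZl// ?mulrDr//; exact: integrable_subitv fi.
Qed.

Lemma primitive_le a b F f (g : R -> R) : a <= b -> primitive a b F f ->
  mu.-integrable `[a, b] (EFin \o g) ->
  (forall s, a <= s <= b -> f s <= g s) ->
  F b - F a <= \int[mu]_(x in `[a, b]) g x.
Proof.
move=> ab Ff gi fg; rewrite (primitiveB Ff)//.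
by apply: le_Rintegral => //; exact: Ff.1.
Qed.
End Primitive.

(** * Admissible curves *)

Section AdmissibleCurves.
Variable R : realType.
Implicit Types (a b s t : R) (c : R -> pt R) (u v w : R -> R).
Notation mu := (@lebesgue_measure R).

(** The integrand of [clength]. On the axis the quotient is 0 / 0 = 0, so only [u] and [v] count
    there. *)
Definition speed c u v w t : R :=
  Num.sqrt (u t ^+ 2 + v t ^+ 2 + (rcyl (c t) * w t) ^+ 2 / rcyl (c t) ^+ 2).

Lemma rcyl_ge0 (q : pt R) : 0 <= rcyl q.
Proof. exact: sqrtr_ge0. Qed.

Lemma sqr_rcyl (q : pt R) : rcyl q ^+ 2 = px q ^+ 2 + py q ^+ 2.
Proof. by rewrite sqr_sqrtr// addr_ge0// sqr_ge0. Qed.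

Lemma speed_ge0 c u v w t : 0 <= speed c u v w t.
Proof. exact: sqrtr_ge0. Qed.

Lemma sqr_speed c u v w t : speed c u v w t ^+ 2 =
  u t ^+ 2 + v t ^+ 2 + (if rcyl (c t) == 0 then 0 else w t ^+ 2).
Proof.
rewrite sqr_sqrtr; last by rewrite !addr_ge0 ?divr_ge0 ?sqr_ge0.
by case: eqP => [->|/eqP r0]; [rewrite mul0r expr0n/= mul0r | congr (_ + _); field].
Qed.

Lemma speed_le c u v w t : speed c u v w t <= `|u t| + `|v t| + `|w t|.
Proof.
rewrite -(@ler_pXn2r _ 2) ?nnegrE ?speed_ge0 ?addr_ge0// sqr_speed.
rewrite -[u t ^+ 2]real_normK ?num_real// -[v t ^+ 2]real_normK ?num_real//.
rewrite -[w t ^+ 2]real_normK ?num_real//.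
have := normr_ge0 (u t); have := normr_ge0 (v t); have := normr_ge0 (w t).
by case: ifP => _; nra.
Qed.

(* Cauchy-Schwarz; on the axis the last term vanishes. *)
Lemma le_speed c u v w t (p q k : R) : p ^+ 2 + q ^+ 2 + (rcyl (c t) * k) ^+ 2 <= 1 ->
  u t * p + v t * q + rcyl (c t) * w t * k <= speed c u v w t.
Proof.
move=> pqk; have S0 := speed_ge0 c u v w t.
have [L0|L0] := leP (u t * p + v t * q + rcyl (c t) * w t * k) 0.
  exact: le_trans L0 S0.
rewrite -(@ler_pXn2r _ 2) ?nnegrE ?(ltW L0)// sqr_speed.
move: pqk; case: eqP => [->|_].
  rewrite !mul0r expr0n addr0 => pq.
  apply: (@le_trans _ _ ((u t ^+ 2 + v t ^+ 2) * (p ^+ 2 + q ^+ 2))).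
    rewrite -subr_ge0.
    have -> : (u t ^+ 2 + v t ^+ 2) * (p ^+ 2 + q ^+ 2) - (u t * p + v t * q + 0) ^+ 2
      = (u t * q - v t * p) ^+ 2 by ring.
    exact: sqr_ge0.
  by rewrite addr0 ler_piMr// addr_ge0 ?sqr_ge0.
set z := rcyl (c t) * k; rewrite mulrAC -[_ * k * _]/(z * w t) => pqz.
apply: (@le_trans _ _ ((u t ^+ 2 + v t ^+ 2 + w t ^+ 2) * (p ^+ 2 + q ^+ 2 + z ^+ 2))).
  rewrite -subr_ge0.
  have -> : (u t ^+ 2 + v t ^+ 2 + w t ^+ 2) * (p ^+ 2 + q ^+ 2 + z ^+ 2) -
      (u t * p + v t * q + z * w t) ^+ 2
    = (u t * q - v t * p) ^+ 2 + (u t * z - w t * p) ^+ 2 + (v t * z - w t * q) ^+ 2.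
    ring.
  by rewrite !addr_ge0 ?sqr_ge0.
by rewrite ler_piMr// !addr_ge0 ?sqr_ge0.
Qed.

Section Rep.
Variables (a b : R) (c : R -> pt R) (u v w : R -> R).
Hypothesis cR : adm_rep a b c u v w.

Lemma adm_rep_le : a <= b. Proof. by case: cR. Qed.

Lemma adm_rep_px : primitive a b (@px R \o c) u.
Proof. by case: cR => _ [_ [_ [_ [ui [_ [_ E]]]]]]; split => // s /E[]. Qed.

Lemma adm_rep_py : primitive a b (@py R \o c) v.
Proof. by case: cR => _ [_ [_ [_ [_ [vi [_ E]]]]]]; split => // s /E[_ []]. Qed.

Lemma adm_rep_pz : primitive a b (@pz R \o c) (fun t => rcyl (c t) * w t).
Proof. by case: cR => _ [_ [_ [_ [_ [_ [wi E]]]]]]; split => // s /E[_ []]. Qed.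

Lemma adm_rep_measurable_rcyl : measurable_fun `[a, b] (@rcyl R \o c).
Proof.
have xc := primitive_continuous adm_rep_le adm_rep_px.
have yc := primitive_continuous adm_rep_le adm_rep_py.
apply: (measurableT_comp (f := @Num.sqrt R)).
  exact: continuous_measurable_fun (@sqrt_continuous R).
by apply: measurable_funD; apply: measurable_funX;
  apply: subspace_continuous_measurable_fun.
Qed.

(** On a bounded interval |w| <= 1 + w ^ 2 is integrable. [adm_rep] provides integrability for r w,
    while off the axis the speed contains [w] itself. *)
Lemma adm_rep_integrable_w : mu.-integrable `[a, b] (EFin \o w).
Proof.
case: cR => ab [_ [_ [[mw w2] _]]].
have one : mu.-integrable `[a, b] (EFin \o cst (1 : R)).
  have := @continuous_compact_integrable R (cst 1) `[a, b] (@segment_compact _ a b).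
  by apply; apply: continuous_subspaceT; exact: cst_continuous.
have w2i : mu.-integrable `[a, b] (EFin \o (fun t => w t ^+ 2)).
  apply/integrableP; split; first exact/measurable_EFinP/measurable_funX.
  by under eq_integral => x _ do rewrite /= ger0_norm ?sqr_ge0//.
apply: (le_integrable _ _ _ (integrable_itvD one w2i)) => //.
  exact/measurable_EFinP.
move=> x _ /=; rewrite lee_fin [leRHS]ger0_norm ?addr_ge0 ?sqr_ge0//.
by rewrite -[w x ^+ 2]real_normK ?num_real//; have := normr_ge0 (w x); nra.
Qed.

Lemma adm_rep_integrable_speed : mu.-integrable `[a, b] (EFin \o speed c u v w).
Proof.
have ui := adm_rep_px.1; have vi := adm_rep_py.1; have wi := adm_rep_integrable_w.
have sumi := integrable_itvD (integrable_itvD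
  (integrable_norm ui) (integrable_norm vi)) (integrable_norm wi).
have mf f : mu.-integrable `[a, b] (EFin \o f) -> measurable_fun `[a, b] f.
  by move=> /measurable_int/measurable_EFinP.
apply: (le_integrable _ _ _ sumi) => //; last first.
  move=> x _; rewrite /= lee_fin ger0_norm ?speed_ge0// ger0_norm ?addr_ge0//.
  exact: speed_le.
apply/measurable_EFinP.
(* Measurability is read off the form without quotient, where the axis becomes a measurable case
   distinction. *)
rewrite (_ : speed c u v w = (fun s => Num.sqrt s) \o (fun t => u t ^+ 2 + v t ^+ 2 +
    (if rcyl (c t) == 0 then 0 else w t ^+ 2))); last first.
  by apply/funext => t; rewrite /= -sqr_speed sqrtr_sqr ger0_norm ?speed_ge0.
apply: measurableT_comp; first exact: continuous_measurable_fun (@sqrt_continuous R).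
apply: measurable_funD.
  by apply: measurable_funD; apply: measurable_funX; exact: mf.
apply: measurable_fun_if => //.
  exact: (measurable_fun_eqr adm_rep_measurable_rcyl).
apply: measurable_funX; apply: measurable_funS (mf _ wi) => //.
Qed.

Lemma clengthE : clength a b c u v w = (\int[mu]_(t in `[a, b]) speed c u v w t)%:E.
Proof.
rewrite /clength /Rintegral fineK//.
exact: integrable_fin_num adm_rep_integrable_speed.
Qed.

End Rep.

End AdmissibleCurves.

(** * The calibration *)

Section Derivatives.
Variable R : realType.
Implicit Types (f g : R -> R) (z : R).

Lemma is_deriveMf f g z (df dg : R) : is_derive z 1 f df -> is_derive z 1 g dg ->
  is_derive z 1 (fun t => f t * g t) (df * g z + dg * f z).
Proof.
move=> Df Dg; have H := is_deriveM Df Dg.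
by apply: is_derive_eq H _; rewrite /GRing.scale/=; ring.
Qed.

Lemma is_deriveDf f g z (df dg : R) : is_derive z 1 f df -> is_derive z 1 g dg ->
  is_derive z 1 (fun t => f t + g t) (df + dg).
Proof. by move=> Df Dg; have H := is_deriveD Df Dg. Qed.

Lemma is_deriveZf f z (k df : R) : is_derive z 1 f df ->
  is_derive z 1 (fun t => k * f t) (k * df).
Proof. by move=> Df; have H := is_deriveZ k Df. Qed.

Lemma is_derive_sinZ (k z : R) :
  is_derive z 1 (fun t => sin (k * t)) (k * cos (k * z)).
Proof.
have H := @is_derive1_comp R sin (fun t => k * t) z _ _ (is_derive_sin _)
  (is_deriveZf k (is_derive_id z 1)).
by apply: is_derive_eq H _; rewrite mulr1 mulrC.
Qed.

Lemma is_derive_cosZ (k z : R) :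
  is_derive z 1 (fun t => cos (k * t)) (- (k * sin (k * z))).
Proof.
have H := @is_derive1_comp R cos (fun t => k * t) z _ _ (is_derive_cos _)
  (is_deriveZf k (is_derive_id z 1)).
by apply: is_derive_eq H _; rewrite mulr1 mulNr mulrC.
Qed.

Lemma cos_le_cos (x y : R) : `|x| <= y -> y <= pi -> cos y <= cos x.
Proof.
move=> xy ypi; have y0 := le_trans (normr_ge0 x) xy.
rewrite -(cos_norm x) leNgt ltr_cos -?leNgt// in_itv/= ?normr_ge0 ?y0//=.
exact: le_trans xy ypi.
Qed.

End Derivatives.

(** * Lower bound for the length between antipodal points *)

Section LowerBound.
Variable R : realType.
Notation mu := (@lebesgue_measure R).

Lemma Rintegral_itv_cst (a b k : R) : a <= b ->
  \int[mu]_(t in `[a, b]) (cst k t) = k * (b - a).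
Proof.
rewrite le_eqVlt => /predU1P[<-|ab]; first by rewrite set_itv1 Rintegral_set1 subrr mulr0.
have muab : fine (@lebesgue_measure R `[a, b]) = b - a.
  by rewrite lebesgue_measure_itv/= lte_fin ab.
by rewrite Rintegral_cst// [fine _]muab.
Qed.

Section CompositionWithTrigonometric.
Variables (a b om : R) (tau sg : R -> R).
Hypotheses (ab : a <= b) (tausg : primitive a b tau sg).

Lemma primitive_sin :
  primitive a b (fun t => sin (om * tau t)) (fun t => sg t * (om * cos (om * tau t))).
Proof.
apply: (primitive_comp_derive2 (phi := fun z => sin (om * z))
  (phi' := fun z => om * cos (om * z)) (phi'' := fun z => om * - (om * sin (om * z)))
  (K := om ^+ 2)) => //.
- by move=> z; exact: is_derive_sinZ.
- by move=> z; apply: is_deriveZf; exact: is_derive_cosZ.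
- move=> z; rewrite mulrN normrN mulrA normrM -expr2 ger0_norm ?sqr_ge0//.
  by rewrite ler_piMr ?sqr_ge0// sin_max.
Qed.

Lemma primitive_cos :
  primitive a b (fun t => cos (om * tau t)) (fun t => sg t * - (om * sin (om * tau t))).
Proof.
apply: (primitive_comp_derive2 (phi := fun z => cos (om * z))
  (phi' := fun z => - (om * sin (om * z))) (phi'' := fun z => - (om * (om * cos (om * z))))
  (K := om ^+ 2)) => //.
- by move=> z; exact: is_derive_cosZ.
- move=> z; under eq_fun do rewrite -mulNr; rewrite -mulNr.
  by apply: is_deriveZf; exact: is_derive_sinZ.
- move=> z; rewrite normrN mulrA normrM -expr2 ger0_norm ?sqr_ge0//.
  by rewrite ler_piMr ?sqr_ge0// cos_max.
Qed.

End CompositionWithTrigonometric.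

(** The increase of Phi when the planar part goes from (x, y) to (- x, - y), with [s] and [c] the
    sine and cosine at the final clock time: the surplus over T is 4 om (x ^ 2 + y ^ 2) (1 - s) /
    c. *)
Lemma calibration_increment (W om T za zb s c x y : R) : 0 < om -> 0 < c -> s <= 1 ->
  2 * W * (zb - za) = T ->
  T <= 2 * W * zb + (- om * (s / c * (- x * - x + - y * - y + (x ^+ 2 + y ^+ 2))) +
         - (2 * om) * ((x * - x + y * - y) / c)) -
       (2 * W * za + (- om * (- s / c * (x * x + y * y + (x ^+ 2 + y ^+ 2))) +
         - (2 * om) * ((x * x + y * y) / c))).
Proof.
move=> om0 c0 s1 zT; rewrite -subr_ge0.
have -> : forall e1 e2, 2 * W * zb + e1 - (2 * W * za + e2) - T =
    2 * W * (zb - za) - T + (e1 - e2) by move=> e1 e2; ring.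
have -> : 2 * W * (zb - za) - T + (- om * (s / c * (- x * - x + - y * - y + (x ^+ 2 + y ^+ 2))) +
         - (2 * om) * ((x * - x + y * - y) / c) -
         (- om * (- s / c * (x * x + y * y + (x ^+ 2 + y ^+ 2))) +
         - (2 * om) * ((x * x + y * y) / c))) =
   2 * W * (zb - za) - T + 4 * om * (x ^+ 2 + y ^+ 2) * (1 - s) / c.
  by ring.
rewrite zT subrr add0r divr_ge0 ?(ltW c0)// mulr_ge0 ?subr_ge0//.
by rewrite !mulr_ge0 ?addr_ge0 ?sqr_ge0 ?(ltW om0).
Qed.

(* Multiplied by [sg], the gap is at least
   |(u, v) + om * sg * (S * (x, y) + (x0, y0)) / C| ^ 2 + (w - W * r * sg) ^ 2,
   without the last term on the axis. *)
Lemma calibration_derivative (W om S C sg x y x0 y0 r u v w : R) :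
  om ^+ 2 = W ^+ 2 -> C != 0 -> C ^+ 2 + S ^+ 2 = 1 -> 0 < sg ->
  r ^+ 2 = x ^+ 2 + y ^+ 2 ->
  u ^+ 2 + v ^+ 2 + (if r == 0 then 0 else w ^+ 2) <= sg ^+ 2 ->
  2 * W * (r * w) +
   (- om * ((sg * (om * C) / C + sg * - (om * S) * - C ^- 2 * S) *
            (x * x + y * y + (x0 ^+ 2 + y0 ^+ 2)) +
            (u * x + u * x + (v * y + v * y) + 0) * (S / C)) +
    - (2 * om) * ((x0 * u + y0 * v) / C +
                  sg * - (om * S) * - C ^- 2 * (x0 * x + y0 * y))) <= sg.
Proof.
move=> omW C0 CS sg0 rE usg.
rewrite -(ler_pM2l sg0); set e := _ + _.
have D2 : S ^+ 2 * C ^- 2 = C ^- 2 - 1.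
  by rewrite (_ : S ^+ 2 = 1 - C ^+ 2); [field|rewrite -CS; ring].
have -> : sg * e = 2 * W * r * w * sg + u ^+ 2 + v ^+ 2 - om ^+ 2 * (x ^+ 2 + y ^+ 2) * sg ^+ 2
    - (u + om * sg * (S * x + x0) / C) ^+ 2 - (v + om * sg * (S * y + y0) / C) ^+ 2.
  apply/eqP; rewrite -subr_eq0; apply/eqP.
  transitivity (om ^+ 2 * sg ^+ 2 * (x0 ^+ 2 + y0 ^+ 2) * (C ^- 2 - 1 - S ^+ 2 * C ^- 2)).
    by rewrite /e; field.
  by rewrite D2; ring.
rewrite omW -rE.
have Q1 := sqr_ge0 (u + om * sg * (S * x + x0) / C).
have Q2 := sqr_ge0 (v + om * sg * (S * y + y0) / C).
have Q3 := sqr_ge0 (w - W * r * sg).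
move: usg; case: eqP => [->|_] usg; first by rewrite -expr2; nra.
rewrite -expr2; apply: le_trans usg.
rewrite -subr_ge0.
have -> : forall q1 q2, u ^+ 2 + v ^+ 2 + w ^+ 2 -
  (2 * W * r * w * sg + u ^+ 2 + v ^+ 2 - W ^+ 2 * r ^+ 2 * sg ^+ 2 - q1 - q2) =
  q1 + q2 + (w - W * r * sg) ^+ 2 by move=> q1 q2; ring.
by rewrite !addr_ge0.
Qed.

Lemma clength_antipodal_ge a b (c : R -> pt R) u v w (W : R) : W != 0 ->
  adm_rep a b c u v w -> rcyl (c a) != 0 ->
  px (c b) = - px (c a) -> py (c b) = - py (c a) ->
  2 * W * (pz (c b) - pz (c a)) = pi / `|W| ->
  ((pi / `|W|)%:E <= clength a b c u v w)%E.
Proof.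
move=> W0 cR r0 xb yb zb; rewrite (clengthE cR) lee_fin.
set T := pi / `|W|; set L0 := Rintegral _ _ _.
have ab := adm_rep_le cR.
have altb : a < b.
  rewrite lt_neqAle ab andbT; apply: contraNneq r0 => ba.
  (* If a = b, the planar part equals its own opposite, so the point lies on the axis. *)
  have sel (s : R) : s = - s -> s = 0 by lra.
  move: xb yb; rewrite -ba => /sel xa /sel ya.
  by rewrite /rcyl xa ya expr0n addr0 sqrtr0.
rewrite leNgt; apply/negP => L0T.
set om : R := `|W| in T L0T zb *.
have om0 : 0 < om by rewrite normr_gt0.
have bma : 0 < b - a by rewrite subr_gt0.
have e0 : 0 < (T - L0) / (2 * (b - a)) by rewrite divr_gt0 ?subr_gt0// mulr_gt0.
(* The added constant raises the integral of the speed from L0 to L = (L0 + T) / 2, so the clock has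
   a positive rate and its total is still below T. *)
pose sg t := speed c u v w t + (T - L0) / (2 * (b - a)).
have L00 : 0 <= L0 by apply: Rintegral_ge0 => t _; exact: speed_ge0.
have csti : mu.-integrable `[a, b] (EFin \o cst ((T - L0) / (2 * (b - a)))).
  apply: continuous_compact_integrable; first exact: segment_compact.
  by apply: continuous_subspaceT; exact: cst_continuous.
have spi := adm_rep_integrable_speed cR.
have sgi : mu.-integrable `[a, b] (EFin \o sg) by exact: integrable_itvD spi csti.
set L := (L0 + T) / 2.
have LT : L < T by rewrite /L; lra.
have Lpos : 0 < L by rewrite /L; lra.
have intsg : \int[mu]_(t in `[a, b]) sg t = L.
  rewrite RintegralD// -/L0 (Rintegral_itv_cst ((T - L0) / (2 * (b - a))) ab) /L; field.
  by rewrite gt_eqF.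
pose tau t := - L / 2 + \int[mu]_(x in `[a, t]) sg x.
have taua : tau a = - L / 2 by rewrite /tau set_itv1 Rintegral_set1 addr0.
have taub : tau b = L / 2 by rewrite /tau intsg; field.
have sgpos t : 0 < sg t by rewrite ltr_wpDl ?speed_ge0.
have tausg : primitive a b tau sg by split => // s _; rewrite taua.
have tau_bd t : a <= t <= b -> `|om * tau t| <= om * (L / 2).
  move=> /andP[at_ tb]; rewrite normrM gtr0_norm// ler_wpM2l ?(ltW om0)// ler_norml.
  rewrite -mulNr -taua -taub.
  apply/andP; split; rewrite -subr_ge0 (primitiveB tausg)//;
  by apply: Rintegral_ge0 => x _; exact/ltW/sgpos.
(* Since L < T = pi / om, the angle stays strictly inside (- pi / 2, pi / 2), where the cosine is
   bounded below by a positive constant and Phi is regular. *)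
have omL : om * (L / 2) < pi / 2.
  by rewrite mulrA ltr_pM2r ?invr_gt0// mulrC -ltr_pdivlMr.
have omL0 : 0 <= om * (L / 2) by apply: mulr_ge0; [exact: ltW|apply: divr_ge0 => //; exact: ltW].
have pih : pi / 2 <= pi :> R by have := pi_ge0 R; lra.
set c0 := cos (om * (L / 2)).
have c00 : 0 < c0.
  by rewrite cos_gt0_pihalf// omL andbT (lt_le_trans _ omL0)// oppr_lt0 divr_gt0 ?pi_gt0.
have cosc t : a <= t <= b -> c0 <= cos (om * tau t).
  by move=> /tau_bd H; apply: cos_le_cos => //; exact/ltW/(lt_le_trans omL).
(* Phi is assembled together with its derivative: [pD] is 1 / cos (om tau), [pT] is tan (om tau),
   [pr2] is |q| ^ 2 + |q0| ^ 2 and [pl] is q . q0. *)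
have pS := primitive_sin om ab tausg.
have pC := primitive_cos om ab tausg.
have pD := primitiveV ab c00 pC cosc.
have px_ := adm_rep_px cR.
have py_ := adm_rep_py cR.
have pz_ := adm_rep_pz cR.
have pT := primitiveM ab pS pD.
have pr2 := primitiveD (primitiveD
  (primitiveM ab px_ px_) (primitiveM ab py_ py_))
  (primitive_cst a b (rcyl (c a) ^+ 2)).
have p1 := primitiveZ (- om) (primitiveM ab pT pr2).
have pl := primitiveD (primitiveZ (px (c a)) px_)
  (primitiveZ (py (c a)) py_).
have p2 := primitiveZ (- (2 * om)) (primitiveM ab pl pD).
have pPhi := primitiveD (primitiveZ (2 * W) pz_)
   (primitiveD p1 p2).
have := primitive_le ab pPhi sgi.
rewrite intsg /= => H.
suff Hd : T <= L by move: LT; rewrite ltNge Hd.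
apply: le_trans (H _).
  have omLN : om * (- L / 2) = - (om * (L / 2)) by ring.
  rewrite taua taub xb yb omLN sinN cosN -/c0.
  by rewrite sqr_rcyl; apply: calibration_increment => //; exact: sin_le1.
move=> s sab /=; rewrite sqr_rcyl.
apply: (calibration_derivative (W := W) (om := om)).
- by rewrite real_normK ?num_real.
- by rewrite gt_eqF// (lt_le_trans c00) ?cosc.
- exact: cos2Dsin2.
- exact: sgpos.
- exact: sqr_rcyl.
- rewrite -sqr_speed lerXn2r ?nnegrE ?speed_ge0 ?(ltW (sgpos _))//.
  by rewrite lerDl ltW.
Qed.

End LowerBound.

(** * Geodesics *)

Section Geodesics.
Variable R : realType.
Notation mu := (@lebesgue_measure R).

Lemma derive_continuous (f f' : R -> R) :
  (forall t : R, is_derive t 1 f (f' t)) -> continuous f.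
Proof.
by move=> df t; apply/differentiable_continuous/derivable1_diffP; have [] := df t.
Qed.

Lemma L2_continuous (a b : R) (f : R -> R) : continuous f -> L2 `[a, b] f.
Proof.
move=> fc; split.
  by apply: measurable_funTS; exact: continuous_measurable_fun.
have f2c : continuous (fun t => f t ^+ 2).
  by move=> t; apply: cvgM; exact: fc.
have f2i : mu.-integrable `[a, b] (EFin \o (fun t => f t ^+ 2)).
  by apply: continuous_compact_integrable;
    [exact: segment_compact|exact: continuous_subspaceT].
apply: le_lt_trans (integrableP _ _ _ f2i).2.
rewrite le_eqVlt; apply/orP; left; apply/eqP; apply: eq_integral => t _ /=.
by rewrite ger0_norm ?sqr_ge0.
Qed.

Lemma rcyl_continuous (c : R -> pt R) :
  continuous (@px R \o c) -> continuous (@py R \o c) -> continuous (@rcyl R \o c).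
Proof.
move=> xc yc t.
apply: (@continuous_comp _ _ _ (fun s => px (c s) ^+ 2 + py (c s) ^+ 2) (@Num.sqrt R)).
  by apply: cvgD; apply: cvgM; [exact: xc|exact: xc|exact: yc|exact: yc].
exact: sqrt_continuous.
Qed.

(** The vertical control lam r gives z' = lam r ^ 2. This covers the geodesic, with lam = w0, and
    the competitor that beats it after the cut time. *)
Lemma smooth_adm_rep (a b lam : R) (x y z x' y' x'' y'' : R -> R) : a <= b ->
  (forall t : R, is_derive t 1 x (x' t)) -> (forall t : R, is_derive t 1 x' (x'' t)) ->
  (forall t : R, is_derive t 1 y (y' t)) -> (forall t : R, is_derive t 1 y' (y'' t)) ->
  primitive a b z (fun t => lam * (x t ^+ 2 + y t ^+ 2)) ->
  let c t := (x t, y t, z t) : pt R in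
  adm_rep a b c x' y' (fun t => lam * rcyl (c t)).
Proof.
move=> ab dx dx' dy dy' zp c.
have [x'i xE] := primitive_derive a b dx dx'.
have [y'i yE] := primitive_derive a b dy dy'.
have [zi zE] : primitive a b (@pz R \o c) (fun t => rcyl (c t) * (lam * rcyl (c t))).
  apply: primitive_eq zp _ _ => // s _.
  by rewrite mulrCA -expr2 sqr_rcyl.
have rc : continuous (@rcyl R \o c).
  by apply: rcyl_continuous; exact: derive_continuous.
have wc : continuous (fun t => lam * rcyl (c t)).
  by move=> t; apply: cvgMr; exact: rc.
split => //; do ?split => //.
- exact: (L2_continuous _ _ (derive_continuous dx')).1.
- exact: (L2_continuous _ _ (derive_continuous dx')).2.
- exact: (L2_continuous _ _ (derive_continuous dy')).1.
- exact: (L2_continuous _ _ (derive_continuous dy')).2.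
- exact: (L2_continuous _ _ wc).1.
- exact: (L2_continuous _ _ wc).2.
- exact: xE.
- exact: yE.
- exact: zE.
Qed.

(** Projection to the plane does not increase length: this is [le_speed] with a horizontal covector.
    It serves the geodesics with w0 = 0. *)
Lemma clength_euclidean_ge (a b p q : R) (c : R -> pt R) u v w :
  adm_rep a b c u v w -> p ^+ 2 + q ^+ 2 <= 1 ->
  ((p * (px (c b) - px (c a)) + q * (py (c b) - py (c a)))%:E <= clength a b c u v w)%E.
Proof.
move=> cR pq; rewrite (clengthE cR) lee_fin.
have P := primitiveD (primitiveZ p (adm_rep_px cR))
  (primitiveZ q (adm_rep_py cR)).
have ab := adm_rep_le cR.
have := primitive_le ab P (adm_rep_integrable_speed cR).
rewrite /= => H; rewrite !mulrBr addrACA -opprD; apply: H => s _.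
have := @le_speed R c u v w s p q 0; rewrite !mulr0 expr0n !addr0 [p * _]mulrC [q * _]mulrC.
exact.
Qed.

Lemma is_deriveNZf (f : R -> R) (t k df : R) : is_derive t 1 f df ->
  is_derive t 1 (fun s => - (k * f s)) (- (k * df)).
Proof. by move=> Df; have H := is_deriveN (is_deriveZ k Df). Qed.

Section Geodesic.
Variables (q0 : pt R) (u0 v0 w0 : R) (x y z u v : R -> R).
Hypotheses (E1q : E1 q0 u0 v0 w0) (x0 : x 0 = px q0) (y0 : y 0 = py q0)
  (z0 : z 0 = pz q0) (u00 : u 0 = u0) (v00 : v 0 = v0).
Hypotheses (dx : forall t : R, is_derive t 1 x (u t)) (dy : forall t : R, is_derive t 1 y (v t))
  (dz : forall t : R, is_derive t 1 z ((x t ^+ 2 + y t ^+ 2) * w0))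
  (du : forall t : R, is_derive t 1 u (- (w0 ^+ 2 * x t)))
  (dv : forall t : R, is_derive t 1 v (- (w0 ^+ 2 * y t))).
Let gam t : pt R := (x t, y t, z t).

Lemma geodesic_energy t : u t ^+ 2 + v t ^+ 2 + w0 ^+ 2 * (x t ^+ 2 + y t ^+ 2) = 1.
Proof.
pose e t := (u t * u t + v t * v t) + w0 ^+ 2 * (x t * x t + y t * y t).
suff : e t = e 0.
  rewrite /e x0 y0 u00 v00 -!expr2 => ->; move: E1q.
  by rewrite /E1 sqr_rcyl [_ * w0 ^+ 2]mulrC.
apply: is_derive_0_is_cst => s.
have D := is_deriveDf
  (is_deriveDf (is_deriveMf (du s) (du s)) (is_deriveMf (dv s) (dv s)))
  (is_deriveZf (w0 ^+ 2)
  (is_deriveDf (is_deriveMf (dx s) (dx s)) (is_deriveMf (dy s) (dy s)))).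
apply: is_derive_eq D _; ring.
Qed.

Lemma is_derive_sqr_radius (t : R) : is_derive t 1 (fun s => (x s ^+ 2 + y s ^+ 2) * w0)
  ((2 * (x t * u t + y t * v t)) * w0).
Proof.
have D := is_deriveMf (is_deriveDf (is_deriveMf (dx t) (dx t))
  (is_deriveMf (dy t) (dy t))) (is_derive_cst w0 t 1).
by apply: is_derive_eq D _; rewrite /=; ring.
Qed.

Lemma geodesic_adm_rep (t : R) : 0 <= t ->
  adm_rep 0 t gam u v (fun s => w0 * rcyl (gam s)).
Proof.
move=> t0; apply: smooth_adm_rep dx du dy dv _ => //.
apply: primitive_eq (primitive_derive _ _ dz is_derive_sqr_radius) _ _ => // s _.
by rewrite mulrC.
Qed.

Lemma geodesic_clength (t : R) : 0 <= t ->
  clength 0 t gam u v (fun s => w0 * rcyl (gam s)) = t%:E.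
Proof.
move=> t0; rewrite (clengthE (geodesic_adm_rep t0)); congr EFin.
transitivity (\int[mu]_(s in `[0, t]) (cst 1 s)); last first.
  by rewrite Rintegral_itv_cst// subr0 mul1r.
apply: eq_Rintegral => s _ /=.
apply/eqP; rewrite -(@eqrXn2 _ 2)// ?speed_ge0// sqr_speed expr1n.
have E := geodesic_energy s; have Er := sqr_rcyl (gam s).
rewrite -[X in _ == X]E; apply/eqP; congr (_ + _).
by case: eqP Er => [-> <-|_ Er]; rewrite ?expr0n ?mulr0// exprMn Er.
Qed.

(** [minimizer] supplies unspecified controls, so the bound must hold for all of them. The covector
    (u, v, w0) has unit norm, hence its pairing with the velocity is at most the speed; the pairing
    integrates to the increment of x u + y v + 2 w0 z, which grows at unit rate along the
    geodesic. *)
Lemma geodesic_clength_ge (t : R) u' v' w' : adm_rep 0 t gam u' v' w' ->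
  (t%:E <= clength 0 t gam u' v' w')%E.
Proof.
move=> cR; rewrite (clengthE cR) lee_fin.
have t0 := adm_rep_le cR.
have ddu (s : R) : is_derive s 1 (fun s => - (w0 ^+ 2 * x s)) (- (w0 ^+ 2 * u s)).
  exact: is_deriveNZf.
have ddv (s : R) : is_derive s 1 (fun s => - (w0 ^+ 2 * y s)) (- (w0 ^+ 2 * v s)).
  exact: is_deriveNZf.
have pu := primitive_derive 0 t du ddu.
have pv := primitive_derive 0 t dv ddv.
have pz_ := primitive_derive 0 t dz is_derive_sqr_radius.
(* [w0 * z] enters twice: once differentiated through the given controls and
   once through the geodesic equation. *)
have P := primitiveD (primitiveD
  (primitiveM t0 (adm_rep_px cR) pu)
  (primitiveM t0 (adm_rep_py cR) pv))
  (primitiveD (primitiveZ w0 (adm_rep_pz cR))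
     (primitiveZ w0 pz_)).
have := primitive_le t0 P (adm_rep_integrable_speed cR).
rewrite /= /px /py /pz /= => H.
apply: le_trans (H _) => [|s _].
  pose Q s := (x s * u s + y s * v s) + 2 * w0 * z s + - 1 * s.
  suff : Q t = Q 0 by rewrite /Q; lra.
  apply: is_derive_0_is_cst => s.
  have D := is_deriveDf (is_deriveDf
    (is_deriveDf (is_deriveMf (dx s) (du s)) (is_deriveMf (dy s) (dv s)))
    (is_deriveZf (2 * w0) (dz s))) (is_deriveZf (- 1) (is_derive_id s 1)).
  apply: is_derive_eq D _; rewrite mulr1; apply/eqP; rewrite subr_eq0; apply/eqP.
  rewrite -[RHS](geodesic_energy s); ring.
have := @le_speed R gam u' v' w' s (u s) (v s) w0.
rewrite exprMn sqr_rcyl [_ * w0 ^+ 2]mulrC geodesic_energy lexx => /(_ isT).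
apply: le_trans; rewrite le_eqVlt; apply/orP; left; apply/eqP; ring.
Qed.

Lemma geodesic_antipodal : w0 != 0 -> let T := pi / `|w0| in
  [/\ x T = - px q0, y T = - py q0 & 2 * w0 * (z T - pz q0) = T].
Proof.
move=> w00 T.
have om0 : `|w0| != 0 by rewrite normr_eq0.
have om2 : `|w0| ^+ 2 = w0 ^+ 2 by rewrite real_normK ?num_real.
have omT : `|w0| * T = pi by rewrite /T mulrCA mulfV// mulr1.
have osc f g : (forall t : R, is_derive t 1 f (g t)) ->
    (forall t : R, is_derive t 1 g (- (w0 ^+ 2 * f t))) -> f T = - f 0 /\ g T = - g 0.
  move=> df dg.
  (* [A] and [B] are the coordinates of (om f, g) rotated back by the angle om t, hence constant; at
     t = T the rotation is by pi, that is, a change of sign. *)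
  pose A t := `|w0| * (f t * cos (`|w0| * t)) + -1 * (g t * sin (`|w0| * t)).
  pose B t := g t * cos (`|w0| * t) + `|w0| * (f t * sin (`|w0| * t)).
  have AE : A T = A 0.
    apply: is_derive_0_is_cst => s.
    have D := is_deriveDf
      (is_deriveZf `|w0| (is_deriveMf (df s) (is_derive_cosZ `|w0| s)))
      (is_deriveZf (-1) (is_deriveMf (dg s) (is_derive_sinZ `|w0| s))).
    by apply: is_derive_eq D _; rewrite -om2; ring.
  have BE : B T = B 0.
    apply: is_derive_0_is_cst => s.
    have D := is_deriveDf
      (is_deriveMf (dg s) (is_derive_cosZ `|w0| s))
      (is_deriveZf `|w0| (is_deriveMf (df s) (is_derive_sinZ `|w0| s))).
    by apply: is_derive_eq D _; rewrite -om2; ring.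
  move: AE BE; rewrite /A /B omT mulr0 cospi sinpi cos0 sin0 !mulr0 !addr0 !mulr1 !mulrN1 => AE BE.
  split; last by rewrite -BE opprK.
  by apply: (mulfI om0); rewrite mulrN -AE mulrN opprK.
have [xT uT] := osc _ _ dx du; have [yT vT] := osc _ _ dy dv.
split; [by rewrite xT x0|by rewrite yT y0|].
(* By conservation of energy 2 w0 z + x u + y v grows at unit rate, and x u + y v has the same value
   at 0 and T because position and velocity both change sign. *)
pose Q s := 2 * w0 * z s + (x s * u s + y s * v s) + - 1 * s.
have : Q T = Q 0.
  apply: is_derive_0_is_cst => s.
  have D := is_deriveDf (is_deriveDf
    (is_deriveZf (2 * w0) (dz s))
    (is_deriveDf (is_deriveMf (dx s) (du s)) (is_deriveMf (dy s) (dv s))))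
    (is_deriveZf (- 1) (is_derive_id s 1)).
  apply: is_derive_eq D _; rewrite mulr1; apply/eqP; rewrite subr_eq0; apply/eqP.
  rewrite -[RHS](geodesic_energy s); ring.
rewrite /Q xT uT yT vT z0 !mulrNN mulr0; lra.
Qed.

Lemma primitive_Rintegral (a b : R) (f : R -> R) :
  mu.-integrable `[a, b] (EFin \o f) ->
  primitive a b (fun s => \int[mu]_(r in `[a, s]) f r) f.
Proof. by move=> fi; split => // s _; rewrite set_itv1 Rintegral_set1 add0r. Qed.

(** Up to time T the integral of r ^ 2 is (z T - z 0) / w0, so 2 w0 ^ 2 times it equals T > 0; the
    remaining part is nonnegative. *)
Lemma geodesic_radius_integral_gt0 (t : R) : w0 != 0 -> pi / `|w0| <= t ->
  0 < \int[mu]_(s in `[0, t]) (x s ^+ 2 + y s ^+ 2).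
Proof.
move=> w00 Tt; have [_ _] := geodesic_antipodal w00.
have T0 : 0 < pi / `|w0| by rewrite divr_gt0 ?pi_gt0 ?normr_gt0.
have rc : continuous (fun s => x s ^+ 2 + y s ^+ 2).
  have xc := derive_continuous dx; have yc := derive_continuous dy.
  by move=> s; apply: cvgD; apply: cvgM; [exact: xc|exact: xc|exact: yc|exact: yc].
have ri : mu.-integrable `[0, t] (EFin \o (fun s => x s ^+ 2 + y s ^+ 2)).
  by apply: continuous_compact_integrable; [exact: segment_compact|exact: continuous_subspaceT].
have pz_ := primitive_derive 0 (pi / `|w0|) dz
  is_derive_sqr_radius.
rewrite -z0 (primitiveB pz_)// ?(ltW T0)// RintegralZr//; last first.
  by apply: integrable_subitv ri.
rewrite (@Rintegral_itv_split R 0 t (pi / `|w0|) t)// ?(ltW T0)//.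
have : 0 <= \int[mu]_(s in `[pi / `|w0|, t]) (x s ^+ 2 + y s ^+ 2).
  by apply: Rintegral_ge0 => s _; rewrite addr_ge0 ?sqr_ge0.
set I1 := \int[mu]_(_ in _) _; set I2 := \int[mu]_(_ in _) _ => I10 E.
rewrite ltr_wpDr// -(@pmulr_rgt0 _ (2 * w0 ^+ 2)); first by move: E T0; rewrite expr2; nra.
by rewrite mulr_gt0// exprn_even_gt0.
Qed.

(* The competitor perturbs the geodesic, inside the plane of (x, y), by
   [h * d * sin (pi s / t)]: the direction d is chosen so that the first
   variation of [int r^2] vanishes, and the value of [lam] restores the final
   height. *)
Lemma geodesic_shortcut (t : R) : w0 != 0 -> pi / `|w0| < t ->
  exists c' u' v' w', [/\ adm_rep 0 t c' u' v' w', c' 0 = gam 0, c' t = gam t &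
    (clength 0 t c' u' v' w' < t%:E)%E].
Proof.
move=> w00 Tt.
have T0 : 0 < pi / `|w0| by rewrite divr_gt0 ?pi_gt0 ?normr_gt0.
have tpos := lt_trans T0 Tt; have t0 := ltW tpos.
have M0 := geodesic_radius_integral_gt0 w00 (ltW Tt).
pose th := pi / t; pose sn s := sin (th * s); pose cs s := cos (th * s).
have th0 : 0 < th by rewrite divr_gt0 ?pi_gt0.
(* The only use of t > pi / |w0|: the frequency of the perturbation is below that of the
   oscillator. *)
have thw : th ^+ 2 < w0 ^+ 2.
  rewrite -[w0 ^+ 2]real_normK ?num_real// ltrXn2r// ?nnegrE ?(ltW th0)//.
  by rewrite ltr_pdivrMr// mulrC -ltr_pdivrMr ?normr_gt0.
have snt : sn t = 0 by rewrite /sn /th divfK ?sinpi// gt_eqF.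
have sn0 : sn 0 = 0 by rewrite /sn mulr0 sin0.
have dsn (s : R) : is_derive s 1 sn (th * cs s) by exact: is_derive_sinZ.
have dcs (s : R) : is_derive s 1 cs (- (th * sn s)) by exact: is_derive_cosZ.
have dthcs (s : R) : is_derive s 1 (fun s => th * cs s) (th * - (th * sn s)).
  exact: is_deriveZf.
have psn := primitive_derive 0 t dsn dthcs.
have pcs : primitive 0 t cs (fun s => - (th * sn s)).
  exact: (primitive_derive _ _ dcs (fun s => is_deriveNZf _ (dsn s))).
have pu : primitive 0 t u (fun s => - (w0 ^+ 2 * x s)).
  exact: (primitive_derive _ _ du (fun s => is_deriveNZf _ (dx s))).
have pv : primitive 0 t v (fun s => - (w0 ^+ 2 * y s)).
  exact: (primitive_derive _ _ dv (fun s => is_deriveNZf _ (dy s))).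
have pid : primitive 0 t id (cst 1).
  exact: (@primitive_derive R 0 t id (cst 1) (cst 0)).
have cint f : continuous f -> mu.-integrable `[0, t] (EFin \o f).
  move=> fc; apply: continuous_compact_integrable; first exact: segment_compact.
  exact: continuous_subspaceT.
have xc := derive_continuous dx; have yc := derive_continuous dy.
have snc := derive_continuous dsn.
pose r2 s := x s ^+ 2 + y s ^+ 2.
have pr2 : primitive 0 t (fun s => \int[mu]_(r in `[0, s]) r2 r) r2.
  apply: primitive_Rintegral; apply: cint => s.
  by apply: cvgD; apply: cvgM; [exact: xc|exact: xc|exact: yc|exact: yc].
have pxs : primitive 0 t (fun s => \int[mu]_(r in `[0, s]) (x r * sn r)) (fun s => x s * sn s).
  by apply: primitive_Rintegral; apply: cint => s; apply: cvgM; [exact: xc|exact: snc].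
have pys : primitive 0 t (fun s => \int[mu]_(r in `[0, s]) (y r * sn r)) (fun s => y s * sn s).
  by apply: primitive_Rintegral; apply: cint => s; apply: cvgM; [exact: yc|exact: snc].
have pss : primitive 0 t (fun s => \int[mu]_(r in `[0, s]) (sn r ^+ 2)) (fun s => sn s ^+ 2).
  by apply: primitive_Rintegral; apply: cint => s; apply: cvgM; exact: snc.
set Ir2 := fun s => _ in pr2; set Ixs := fun s => _ in pxs; set Iys := fun s => _ in pys.
set Iss := fun s => _ in pss.
have I0 : [/\ Ir2 0 = 0, Ixs 0 = 0, Iys 0 = 0 & Iss 0 = 0].
  by rewrite /Ir2 /Ixs /Iys /Iss set_itv1 !Rintegral_set1.
have [Ir20 Ixs0 Iys0 Iss0] := I0.
have psc := primitiveM t0 psn pcs.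
have pusn := primitiveM t0 pu psn.
have pvsn := primitiveM t0 pv psn.
(* Both s - 2 [Iss] s and [sn] s [cs] s / [th] have derivative cos (2 th s), and the latter vanishes
   at both ends. *)
have IssE : Iss t = t / 2.
  have := primitiveB (primitiveD pid
    (primitiveZ (- 2) pss)) (lexx 0) t0 (lexx t).
  have := primitiveB (primitiveZ th^-1 psc) (lexx 0) t0 (lexx t).
  rewrite /= snt sn0 !mul0r mulr0 Iss0.
  set E1 := \int[mu]_(_ in _) _; set E2 := \int[mu]_(_ in _) _ => H1 H2.
  have E12 : E1 = E2.
    apply: eq_Rintegral => s _ /=.
    rewrite /sn /cs; transitivity (cos (th * s) ^+ 2 - sin (th * s) ^+ 2).
      by field; rewrite gt_eqF.
    by rewrite cos2sin2; ring.
  move: H1 H2; rewrite E12; lra.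
(* The direction is orthogonal to ([Ixs] t, [Iys] t); when that vector is zero, any direction will
   do. *)
have [d1 [d2 [d0 dI]]] : exists d1 d2 : R, 0 < d1 ^+ 2 + d2 ^+ 2 /\
    d1 * Ixs t + d2 * Iys t = 0.
  have [H|] := ltP 0 ((- Iys t) ^+ 2 + Ixs t ^+ 2).
    by exists (- Iys t), (Ixs t); split => //; ring.
  move=> H; exists 1, 0; split; first by rewrite expr1n expr0n addr0.
  have := sqr_ge0 (- Iys t); have := sqr_ge0 (Ixs t) => H1 H2.
  have : Ixs t ^+ 2 = 0 by lra.
  by move/eqP; rewrite sqrf_eq0 => /eqP ->; ring.
set M := Ir2 t; have M0' : 0 < M by [].
pose m := (d1 ^+ 2 + d2 ^+ 2) * Iss t.
have m0 : 0 < m by rewrite mulr_gt0// IssE divr_gt0.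
(* h ^ 2 is half the value at which th ^ 2 (M + h ^ 2 m) would reach w0 ^ 2 M, so th ^ 2 M1 stays
   strictly below w0 ^ 2 M. *)
pose h := Num.sqrt ((w0 ^+ 2 - th ^+ 2) * M / (2 * m * th ^+ 2)).
have h2 : h ^+ 2 = (w0 ^+ 2 - th ^+ 2) * M / (2 * m * th ^+ 2).
  rewrite sqr_sqrtr//; apply: divr_ge0.
    by apply: mulr_ge0; [rewrite subr_ge0 ltW|exact: ltW].
  by apply: mulr_ge0; [apply: mulr_ge0; [|exact: ltW]|exact: sqr_ge0].
have h20 : 0 < h ^+ 2.
  rewrite h2 divr_gt0// mulr_gt0 ?subr_gt0//; first by rewrite mulr_gt0.
  by rewrite exprn_gt0.
pose x1 s := x s + (h * d1) * sn s; pose y1 s := y s + (h * d2) * sn s.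
pose u1 s := u s + (h * d1) * (th * cs s); pose v1 s := v s + (h * d2) * (th * cs s).
pose M1 := M + h ^+ 2 * m.
have M10 : 0 < M1 by rewrite addr_gt0// mulr_gt0.
(* [M1] is the integral of r ^ 2 along the competitor, so lam M1 = w0 M gives it the same final
   height. *)
pose lam := w0 * M / M1.
pose A s := Ir2 s + 2 * h * (d1 * Ixs s + d2 * Iys s) + h ^+ 2 * (d1 ^+ 2 + d2 ^+ 2) * Iss s.
have pA : primitive 0 t A (fun s => x1 s ^+ 2 + y1 s ^+ 2).
  apply: primitive_eq (primitiveD (primitiveD pr2
    (primitiveZ (2 * h) (primitiveD (primitiveZ d1 pxs)
       (primitiveZ d2 pys))))
    (primitiveZ (h ^+ 2 * (d1 ^+ 2 + d2 ^+ 2)) pss)) _ _ => s _ //=.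
  by rewrite /x1 /y1 /r2; ring.
have At : A t = M1 by rewrite /A dI /M1 /m -/M; ring.
have A0 : A 0 = 0 by rewrite /A Ir20 Ixs0 Iys0 Iss0; ring.
pose z1 s := pz q0 + lam * A s.
have pz1 : primitive 0 t z1 (fun s => lam * (x1 s ^+ 2 + y1 s ^+ 2)).
  apply: primitive_eq (primitiveD (primitive_cst 0 t (pz q0))
    (primitiveZ lam pA)) _ _ => s _ //=.
  by rewrite add0r.
have dx1 (s : R) : is_derive s 1 x1 (u1 s) by apply: is_deriveDf => //; exact: is_deriveZf.
have dy1 (s : R) : is_derive s 1 y1 (v1 s) by apply: is_deriveDf => //; exact: is_deriveZf.
have du1 (s : R) : is_derive s 1 u1 (- (w0 ^+ 2 * x s) + (h * d1) * (th * - (th * sn s))).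
  by apply: is_deriveDf => //; exact: is_deriveZf.
have dv1 (s : R) : is_derive s 1 v1 (- (w0 ^+ 2 * y s) + (h * d2) * (th * - (th * sn s))).
  by apply: is_deriveDf => //; exact: is_deriveZf.
pose c s : pt R := (x1 s, y1 s, z1 s).
have cR := smooth_adm_rep t0 dx1 du1 dy1 dv1 pz1.
exists c, u1, v1, (fun s => lam * rcyl (c s)); split => //.
- by rewrite /c /gam /x1 /y1 /z1 sn0 A0 z0 !mulr0 !addr0.
- rewrite /c /gam /x1 /y1 /z1 snt At !mulr0 !addr0; congr (_, _, _).
  have pz_ := primitive_derive 0 t dz is_derive_sqr_radius.
  have := primitiveB pz_ (lexx 0) t0 (lexx t).
  rewrite RintegralZr//; last exact: pr2.1.
  rewrite -/(Ir2 t) -/M z0 => zE.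
  have -> : lam * M1 = M * w0 by rewrite /lam; field; rewrite gt_eqF.
  by rewrite -zE; ring.
rewrite (clengthE cR) lte_fin.
(* The energy of the competitor up to time s, with the terms in [cs] integrated by parts; the
   boundary terms carry the factor [sn] and vanish at 0 and t. *)
pose G s := s - w0 ^+ 2 * Ir2 s + 2 * h * (d1 * (u s * sn s + w0 ^+ 2 * Ixs s) +
   d2 * (v s * sn s + w0 ^+ 2 * Iys s)) +
   h ^+ 2 * (d1 ^+ 2 + d2 ^+ 2) * (th * (sn s * cs s) + th ^+ 2 * Iss s) + lam ^+ 2 * A s.
have pG : primitive 0 t G (fun s => u1 s ^+ 2 + v1 s ^+ 2 + lam ^+ 2 * (x1 s ^+ 2 + y1 s ^+ 2)).
  have P1 := primitiveD pid (primitiveZ (- w0 ^+ 2) pr2).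
  have P2 := primitiveZ (2 * h) (primitiveD
    (primitiveZ d1 (primitiveD pusn (primitiveZ (w0 ^+ 2) pxs)))
    (primitiveZ d2 (primitiveD pvsn (primitiveZ (w0 ^+ 2) pys)))).
  have P3 := primitiveZ (h ^+ 2 * (d1 ^+ 2 + d2 ^+ 2)) (primitiveD
    (primitiveZ th psc) (primitiveZ (th ^+ 2) pss)).
  apply: primitive_eq (primitiveD (primitiveD
    (primitiveD P1 P2) P3) (primitiveZ (lam ^+ 2) pA)) _ _ => s _ /=.
    by rewrite /G; ring.
  have E : 1 = u s ^+ 2 + v s ^+ 2 + w0 ^+ 2 * r2 s.
    by rewrite geodesic_energy.
  by rewrite {1}E /u1 /v1; ring.
have pH := primitiveZ 2^-1 (primitiveD pid pG).
(* From speed <= (1 + speed ^ 2) / 2, the length is at most (t + energy) / 2, so an energy below t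
   suffices. *)
have le_amgm : \int[mu]_(s in `[0, t]) speed c u1 v1 (fun s => lam * rcyl (c s)) s <=
    2^-1 * (t + G t) - 2^-1 * (0 + G 0).
  rewrite (primitiveB pH)//; apply: le_Rintegral => //.
  - exact: adm_rep_integrable_speed cR.
  - exact: pH.1.
  move=> s _ /=; set sp := speed _ _ _ _ _.
  have spE : sp ^+ 2 <= u1 s ^+ 2 + v1 s ^+ 2 + lam ^+ 2 * (x1 s ^+ 2 + y1 s ^+ 2).
    rewrite sqr_speed lerD2l exprMn sqr_rcyl.
    by case: ifP => // _; rewrite mulr_ge0 ?addr_ge0 ?sqr_ge0.
  have := sqr_ge0 (sp - 1); nra.
apply: le_lt_trans le_amgm _.
have -> : G 0 = 0 by rewrite /G Ir20 Ixs0 Iys0 Iss0 A0 sn0; ring.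
suff : G t < t by lra.
have -> : G t = t + (th ^+ 2 * M1 - w0 ^+ 2 * M) * (h ^+ 2 * m / M1).
  have -> : G t = t - w0 ^+ 2 * M + 2 * h * w0 ^+ 2 * (d1 * Ixs t + d2 * Iys t) +
      h ^+ 2 * th ^+ 2 * m + lam ^+ 2 * M1.
    by rewrite /G At snt /m -/M; ring.
  by rewrite dI /lam /M1; field; rewrite gt_eqF.
rewrite gtrDl pmulr_llt0; last by rewrite divr_gt0// mulr_gt0.
have -> : th ^+ 2 * M1 - w0 ^+ 2 * M = - ((w0 ^+ 2 - th ^+ 2) * M / 2).
  by rewrite /M1 h2; field; rewrite !gt_eqF.
by rewrite oppr_lt0 divr_gt0// mulr_gt0// subr_gt0.
Qed.

End Geodesic.
End Geodesics.

(** * Cut time and cut locus *)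

Section CutTime.
Variable R : realType.
Variables (q0 : pt R) (u0 v0 w0 : R) (gam : R -> pt R).
Hypotheses (E1q : E1 q0 u0 v0 w0) (geo : geodesic q0 u0 v0 w0 gam).

Lemma geodesic_minimizer : w0 != 0 -> rcyl q0 != 0 -> minimizer 0 (pi / `|w0|) gam.
Proof.
move=> w00 r0; case: geo => x [y] [z] [u] [v] [gE [x0 [y0 [z0 [u00 [v00 D]]]]]].
have dx t := (D t).1; have dy t := (D t).2.1; have dz t := (D t).2.2.1.
have du t := (D t).2.2.2.1; have dv t := (D t).2.2.2.2.
have {gE} -> : gam = fun t => (x t, y t, z t) by apply/funext.
have T0 : 0 <= pi / `|w0| by rewrite divr_ge0 ?pi_ge0.
have cR := geodesic_adm_rep dx dy dz du dv T0.
exists u, v, (fun s => w0 * rcyl (x s, y s, z s)); split => // a b c u' v' w' cR' ca cb.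
rewrite (geodesic_clength E1q x0 y0 u00 v00 dx dy dz du dv)//.
have [xT yT zT] := geodesic_antipodal E1q x0 y0 z0 u00 v00 dx dy dz du dv w00.
apply: clength_antipodal_ge cR' _ _ _ _ => //.
- by rewrite ca /rcyl /px /py /= x0 y0.
- by rewrite ca cb /px /= xT x0.
- by rewrite ca cb /py /= yT y0.
- by rewrite ca cb /pz /= z0 zT.
Qed.

Lemma geodesic_not_minimizer (t : R) : w0 != 0 -> pi / `|w0| < t -> ~ minimizer 0 t gam.
Proof.
move=> w00 Tt; case: geo => x [y] [z] [u] [v] [gE [x0 [y0 [z0 [u00 [v00 D]]]]]].
have dx t := (D t).1; have dy t := (D t).2.1; have dz t := (D t).2.2.1.
have du t := (D t).2.2.2.1; have dv t := (D t).2.2.2.2.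
have {gE} -> : gam = fun t => (x t, y t, z t) by apply/funext.
move=> [u1 [v1 [w1 [cR min]]]].
have [c [u2 [v2 [w2 [cR2 c0 ct]]]]] :=
  geodesic_shortcut E1q x0 y0 z0 u00 v00 dx dy dz du dv w00 Tt.
apply/negP; rewrite -leNgt.
apply: le_trans (min _ _ _ _ _ _ cR2 c0 ct).
exact: (geodesic_clength_ge E1q x0 y0 u00 v00 dx dy dz du dv cR).
Qed.

(** With w0 = 0 the planar projection is a straight line run at unit speed, and
    [clength_euclidean_ge] in its direction (u0, v0) bounds every competitor. *)
Lemma line_minimizer (t : R) : w0 = 0 -> 0 <= t -> minimizer 0 t gam.
Proof.
move=> w00 t0; move: E1q geo; rewrite w00 => E1q' geo'.
case: geo' => x [y] [z] [u] [v] [gE [x0 [y0 [z0 [u00 [v00 D]]]]]].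
have dx t := (D t).1; have dy t := (D t).2.1; have dz t := (D t).2.2.1.
have du t := (D t).2.2.2.1; have dv t := (D t).2.2.2.2.
have {gE} -> : gam = fun t => (x t, y t, z t) by apply/funext.
have cR := geodesic_adm_rep dx dy dz du dv t0.
exists u, v, (fun s => 0 * rcyl (x s, y s, z s)); split => // a b c u' v' w' cR' ca cb.
rewrite (geodesic_clength E1q' x0 y0 u00 v00 dx dy dz du dv)//.
have uv1 : u0 ^+ 2 + v0 ^+ 2 = 1 by move: E1q'; rewrite /E1 expr0n mulr0 addr0.
have lin (f g : R -> R) (k : R) : (forall s : R, is_derive s 1 g (- (0 ^+ 2 * f s))) -> g 0 = k ->
   (forall s : R, is_derive s 1 f (g s)) -> f t - f 0 = k * t.
  move=> dg gk df.
  have gE s : g s = k.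
    rewrite -gk; apply: is_derive_0_is_cst => r.
    by apply: is_derive_eq (dg r) _; rewrite expr0n mul0r oppr0.
  have : f t + - k * t = f 0 + - k * 0.
    apply: (is_derive_0_is_cst (f := fun s => f s + - k * s)) => s.
    have H := is_deriveDf (df s) (is_deriveZf (- k) (is_derive_id s 1)).
    by apply: is_derive_eq H _; rewrite gE mulr1 subrr.
  by rewrite mulr0 addr0 => <-; ring.
have := clength_euclidean_ge (p := u0) (q := v0) cR'; rewrite uv1 lexx => /(_ isT).
rewrite ca cb /px /py /= (lin x u u0)// (lin y v v0)//.
by rewrite !mulrA -mulrDl -!expr2 uv1 mul1r.
Qed.

(** For the supremum it is enough that pi / |w0| is a minimizing time and that no later time is
    one. *)
Lemma tcutE : rcyl q0 != 0 ->
  tcut gam = (if w0 == 0 :> R then +oo%E else (pi / `|w0|)%:E).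
Proof.
move=> r0; rewrite /tcut; case: eqP => [w00|/eqP w00].
  apply/eq_infty => k; apply: le_trans (_ : (`|k| + 1)%:E <= _)%E.
    by rewrite lee_fin (le_trans (ler_norm _))// lerDl.
  apply: ereal_sup_ubound; exists (`|k| + 1) => //=.
  have k0 : 0 < `|k| + 1 by rewrite ltr_wpDl.
  by split => //; apply: line_minimizer => //; exact: ltW.
apply/eqP; rewrite eq_le; apply/andP; split.
  apply: ge_ereal_sup => _ [t [t0 mt] <-]; rewrite lee_fin leNgt.
  by apply/negP => /geodesic_not_minimizer; apply.
apply: ereal_sup_ubound; exists (pi / `|w0|) => //=; split.
  by rewrite divr_gt0 ?pi_gt0 ?normr_gt0.
exact: geodesic_minimizer.
Qed.

End CutTime.

(** * Explicit geodesics *)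

Section GeodesicExistence.
Variable R : realType.

Lemma geodesic_exists (q0 : pt R) (u0 v0 w0 : R) : w0 != 0 ->
  exists gam, geodesic q0 u0 v0 w0 gam.
Proof.
move=> w00.
(* The harmonic oscillator of frequency w0 with initial position [a] and velocity [p]. *)
pose osc (a p t : R) := a * cos (w0 * t) + p / w0 * sin (w0 * t).
pose osc' (a p t : R) := p * cos (w0 * t) + - (a * w0) * sin (w0 * t).
have dosc a p (t : R) : is_derive t 1 (osc a p) (osc' a p t).
  have D := is_deriveDf (is_deriveZf a (is_derive_cosZ w0 t))
    (is_deriveZf (p / w0) (is_derive_sinZ w0 t)).
  by apply: is_derive_eq D _; rewrite /osc'; field.
have dosc' a p (t : R) : is_derive t 1 (osc' a p) (- (w0 ^+ 2 * osc a p t)).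
  have D := is_deriveDf (is_deriveZf p (is_derive_cosZ w0 t))
    (is_deriveZf (- (a * w0)) (is_derive_sinZ w0 t)).
  by apply: is_derive_eq D _; rewrite /osc; field.
pose x := osc (px q0) u0; pose y := osc (py q0) v0.
pose u := osc' (px q0) u0; pose v := osc' (py q0) v0.
(* [int_0^t x^2] for x'' = - w^2 x, from (x x')' = x'^2 - w^2 x^2 and the
   conservation of x'^2 + w^2 x^2 *)
pose k (q p : R) := p ^+ 2 + w0 ^+ 2 * q ^+ 2.
have kE a p t : osc' a p t ^+ 2 + w0 ^+ 2 * osc a p t ^+ 2 = k a p.
  transitivity (k a p * (cos (w0 * t) ^+ 2 + sin (w0 * t) ^+ 2)).
    by rewrite /osc /osc' /k; field.
  by rewrite cos2Dsin2 mulr1.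
pose z0 t := (2 * w0)^-1 * ((k (px q0) u0 + k (py q0) v0) * t +
   -1 * (x t * u t + y t * v t)).
pose z t := pz q0 + - z0 0 + z0 t.
exists (fun t => (x t, y t, z t)), x, y, z, u, v; split=> //.
have osc0 a p : osc a p 0 = a /\ osc' a p 0 = p.
  by rewrite /osc /osc' mulr0 cos0 sin0 !mulr0 !addr0 !mulr1.
rewrite /x /y /u /v !(osc0 _ _).1 !(osc0 _ _).2 /z; do 5?split => //.
  by rewrite addrNK.
move=> t; split; [exact: dosc|split; first exact: dosc].
split; last by split; exact: dosc'.
have dz0 := is_deriveZf ((2 * w0)^-1) (is_deriveDf
  (is_deriveZf (k (px q0) u0 + k (py q0) v0) (is_derive_id t 1))
  (is_deriveZf (-1) (is_deriveDf
    (is_deriveMf (dosc (px q0) u0 t) (dosc' (px q0) u0 t))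
    (is_deriveMf (dosc (py q0) v0 t) (dosc' (py q0) v0 t))))).
have D := is_deriveDf (is_derive_cst (pz q0 + - z0 0) t 1) dz0.
apply: is_derive_eq D _.
by rewrite -(kE (px q0) u0 t) -(kE (py q0) v0 t); field.
Qed.

End GeodesicExistence.

(** * From the cut time to the cut locus *)

Unset Implicit Arguments.

Theorem theorem14 (R : realType) (q0 : pt R) (hq0 : rcyl q0 != 0) :
  (forall (u0 v0 w0 : R) (gam : R -> pt R),
     E1 q0 u0 v0 w0 -> geodesic q0 u0 v0 w0 gam ->
     tcut gam = (if w0 == 0 :> R then +oo%E else (pi / `|w0|)%:E)) /\
  Cut q0 = [set p : pt R | px p = - px q0 /\ py p = - py q0 /\
                           pi * rcyl q0 ^+ 2 / 2 <= `|pz p - pz q0|].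
Proof.
split=> [u0 v0 w0 gam E1q geo|]; first exact: tcutE E1q geo hq0.
have r0 : 0 < rcyl q0 by rewrite lt_neqAle eq_sym hq0 rcyl_ge0.
have endpoint u0 v0 w0 gam : w0 != 0 -> E1 q0 u0 v0 w0 -> geodesic q0 u0 v0 w0 gam ->
    [/\ px (gam (pi / `|w0|)) = - px q0, py (gam (pi / `|w0|)) = - py q0 &
        2 * w0 * (pz (gam (pi / `|w0|)) - pz q0) = pi / `|w0|].
  move=> w00 E1q [x [y [z [u [v [gE [x0 [y0 [z0 [u00 [v00 D]]]]]]]]]]]; rewrite gE.
  have dx t := (D t).1; have dy t := (D t).2.1; have dz t := (D t).2.2.1.
  have du t := (D t).2.2.2.1; have dv t := (D t).2.2.2.2.
  exact: geodesic_antipodal E1q x0 y0 z0 u00 v00 dx dy dz du dv w00.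
apply/seteqP; split => p /=.
  move=> [u0 [v0 [w0 [gam [T [E1q [geo [+ ->]]]]]]]].
  rewrite (tcutE E1q geo hq0); case: eqP => // /eqP w00 [<-].
  have [-> -> zT] := endpoint _ _ _ _ w00 E1q geo; do 2?split => //.
  have om0 : 0 < `|w0| by rewrite normr_gt0.
  have : `|2 * w0 * (pz (gam (pi / `|w0|)) - pz q0)| = pi / `|w0|.
    by rewrite zT ger0_norm// divr_ge0 ?pi_ge0.
  rewrite !normrM ger0_norm// => zE.
  have -> : `|pz (gam (pi / `|w0|)) - pz q0| = pi / 2 * `|w0| ^- 2.
    apply: (mulfI (x := 2 * `|w0|)); first by rewrite mulf_neq0 ?gt_eqF.
    by rewrite zE; field; rewrite gt_eqF.
  (* What remains is r0 ^ 2 w0 ^ 2 <= 1, the unit energy condition with u0 ^ 2 + v0 ^ 2 dropped. *)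
  rewrite mulrAC ler_wpM2l ?divr_ge0 ?pi_ge0//.
  rewrite -[leRHS]mul1r ler_pdivlMr ?exprn_gt0// -E1q real_normK ?num_real//.
  by rewrite lerDr addr_ge0 ?sqr_ge0.
move=> [xp [yp zp]].
set dz := pz p - pz q0 in zp *.
have dz0 : 0 < `|dz|.
  by apply: lt_le_trans zp; rewrite divr_gt0// mulr_gt0 ?pi_gt0// exprn_gt0.
(* Inverts the height relation |dz| = pi / (2 w0 ^ 2), with the sign of [dz]. *)
pose w0 := Num.sg dz * Num.sqrt (pi / (2 * `|dz|)).
have s0 : 0 < Num.sqrt (pi / (2 * `|dz|)) by rewrite sqrtr_gt0 divr_gt0 ?pi_gt0// mulr_gt0.
have dzn : dz != 0 by rewrite -normr_gt0.
have nw : `|w0| = Num.sqrt (pi / (2 * `|dz|)).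
  by rewrite normrM normr_sg dzn mul1r gtr0_norm.
have w02 : w0 ^+ 2 = pi / (2 * `|dz|).
  by rewrite -[w0 ^+ 2]real_normK ?num_real// nw sqr_sqrtr// divr_ge0 ?pi_ge0// mulr_ge0.
have w00 : w0 != 0 by rewrite -normr_gt0 nw.
(* For this w0 the height condition is exactly r0 ^ 2 w0 ^ 2 <= 1; the energy left over goes into
   u0, with v0 = 0. *)
have rw : rcyl q0 ^+ 2 * w0 ^+ 2 <= 1.
  rewrite w02 mulrA ler_pdivrMr ?mulr_gt0// mul1r mulrC.
  by move: zp; rewrite ler_pdivrMr// [`|dz| * _]mulrC.
have E1q : E1 q0 (Num.sqrt (1 - rcyl q0 ^+ 2 * w0 ^+ 2)) 0 w0.
  by rewrite /E1 sqr_sqrtr ?subr_ge0// expr0n addr0 subrK.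
have [gam geo] := geodesic_exists q0 (Num.sqrt (1 - rcyl q0 ^+ 2 * w0 ^+ 2)) 0 w00.
exists (Num.sqrt (1 - rcyl q0 ^+ 2 * w0 ^+ 2)), 0, w0, gam, (pi / `|w0|); split => //.
split => //; split; first by rewrite (tcutE E1q geo hq0) (negbTE w00).
have [xT yT zT] := endpoint _ _ _ _ w00 E1q geo.
have zE : pz (gam (pi / `|w0|)) - pz q0 = dz.
  apply: (mulfI (x := 2 * w0)); first by rewrite mulf_neq0.
  rewrite zT; apply: (mulIf (x := `|w0|)); first by rewrite normr_eq0.
  rewrite divfK ?normr_eq0//.
  have -> : 2 * w0 * dz * `|w0| = 2 * `|dz| * w0 ^+ 2.
    rewrite -[w0 ^+ 2]real_normK ?num_real// nw /w0; set s := Num.sqrt _.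
    by rewrite [in RHS](normrEsg dz); ring.
  by rewrite w02 mulrC divfK// mulf_neq0// gt_eqF.
rewrite [p]surjective_pairing [p.1]surjective_pairing.
rewrite [gam _]surjective_pairing [(gam _).1]surjective_pairing.
move: xT yT zE xp yp; rewrite /dz /px /py /pz => -> -> zE -> ->.
by congr (_, _); lra.
Qed.
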